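(* Let $\Sigma\subset\mathbb{C}P^2$ be an immersed Lagrangian torus, with energy $E(\Sigma)=\frac12\int_\Sigma V\,dx\wedge dy$ (defined in the context). Then $$E(\Sigma)=\int_{\Sigma} d\sigma+\frac18\int_{\Sigma}|H|^2\,d\sigma,$$ where $d\sigma$ is the area element of the induced metric on $\Sigma$ and $H$ is the mean curvature vector of $\Sigma$ in $\mathbb{C}P^2$.
   Context: $\mathbb{C}P^2$ carries the Fubini–Study metric for which the Hopf projection $\mathcal{H}:S^5\to\mathbb{C}P^2$ from the unit sphere $S^5\subset\mathbb{C}^3$ is a Riemannian submersion. The mean curvature vector $H$ is the trace of the second fundamental form (no factor $1/2$). $\langle\cdot,\cdot\rangle$ is the Hermitian inner product of $\mathbb{C}^3$. A Lagrangian torus $\Sigma$ is described by a map $r:\mathbb{R}^2\to S^5$ in global conformal coordinates $(x,y)$ on the universal cover, which is a horizontal lift: the immersion is $\mathcal{H}\circ r$, doubly periodic with respect to a lattice $\Lambda\subset\mathbb{R}^2$ (so $\Sigma=\mathbb{R}^2/\Lambda$ as domain), the induced metric is $ds^2=2e^{v(x,y)}(dx^2+dy^2)$, and $$\langle r,r\rangle=1,\quad \langle r_x,r\rangle=\langle r_y,r\rangle=\langle r_x,r_y\rangle=0,\quad \langle r_x,r_x\rangle=\langle r_y,r_y\rangle=2e^{v}.$$ In particular $d\sigma=2e^v\,dx\wedge dy$. The matrix $\tilde R$ with rows $r,\ r_x/|r_x|,\ r_y/|r_y|$ lies in $\mathrm{U}(3)$, and the Lagrangian angle $\beta$ is the real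 function defined by $e^{i\beta}=\det\tilde R$ (defined up to constants). The potential of the Schrödinger operator associated with $\Sigma$ is the $\Lambda$-periodic function $$V=4e^v+\tfrac14(\beta_x^2+\beta_y^2)+\tfrac{i}{2}\Delta\beta,\qquad \Delta=\partial_x^2+\partial_y^2,$$ and the energy of $\Sigma$ is $E(\Sigma)=\frac12\int_{\Sigma}V\,dx\wedge dy$, the integral being over a fundamental domain of $\Lambda$. *)

(* Defs.v *)
(* Stdlib reals with Coquelicot. *)
From Stdlib Require Import Reals Lra.
From Coquelicot Require Import Coquelicot.
Open Scope R_scope.

(** * Complex vectors *)

Definition C2 : Type := (C * C)%type.
Definition C3 : Type := (C * C * C)%type.

Definition c0 (z : C3) : C := fst (fst z).
Definition c1 (z : C3) : C := snd (fst z).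
Definition c2 (z : C3) : C := snd z.

Definition herm (a b : C3) : C :=
  (c0 a * Cconj (c0 b) + c1 a * Cconj (c1 b) + c2 a * Cconj (c2 b))%C.

Definition norm3 (a : C3) : R := sqrt (Re (herm a a)).

Definition scale3 (c : C) (a : C3) : C3 := (c * c0 a, c * c1 a, c * c2 a)%C.

Definition det3 (a b c : C3) : C :=
  (c0 a * (c1 b * c2 c - c2 b * c1 c)
   - c1 a * (c0 b * c2 c - c2 b * c0 c)
   + c2 a * (c0 b * c1 c - c1 b * c0 c))%C.

Definition herm2 (a b : C2) : C :=
  (fst a * Cconj (fst b) + snd a * Cconj (snd b))%C.

Definition add2 (a b : C2) : C2 := (fst a + fst b, snd a + snd b)%C.
Definition scal2 (t : R) (a : C2) : C2 := (RtoC t * fst a, RtoC t * snd a)%C.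
Definition sub2 (a b : C2) : C2 := add2 a (scal2 (-1) b).

(** * Calculus of maps on the plane *)

Definition smooth2 (f : R -> R -> R) : Prop :=
  forall (n : nat) (x y : R), ex_diff_n f n x y.

(* As for [partial_derive m k], m derivatives in x after k derivatives in y. *)
Definition partialC (m k : nat) (f : R -> R -> C) (x y : R) : C :=
  (partial_derive m k (fun s t => Re (f s t)) x y,
   partial_derive m k (fun s t => Im (f s t)) x y).

Definition partial2 (m k : nat) (f : R -> R -> C2) (x y : R) : C2 :=
  (partialC m k (fun s t => fst (f s t)) x y,
   partialC m k (fun s t => snd (f s t)) x y).

Definition partial3 (m k : nat) (f : R -> R -> C3) (x y : R) : C3 :=
  (partialC m k (fun s t => c0 (f s t)) x y,
   partialC m k (fun s t => c1 (f s t)) x y,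
   partialC m k (fun s t => c2 (f s t)) x y).

Definition smoothC (f : R -> R -> C) : Prop :=
  smooth2 (fun s t => Re (f s t)) /\ smooth2 (fun s t => Im (f s t)).

Definition smooth3 (f : R -> R -> C3) : Prop :=
  smoothC (fun s t => c0 (f s t)) /\
  smoothC (fun s t => c1 (f s t)) /\
  smoothC (fun s t => c2 (f s t)).

(** * Lattices and integrals over a fundamental domain *)

Definition det2 (w1 w2 : R * R) : R := fst w1 * snd w2 - snd w1 * fst w2.

Definition in_lattice (w1 w2 l : R * R) : Prop :=
  exists m n : Z,
    l = (IZR m * fst w1 + IZR n * fst w2, IZR m * snd w1 + IZR n * snd w2).

(* The integral of f dx dy over the fundamental parallelogram
   {s w1 + t w2 : 0 <= s, t <= 1}, parametrised by the unit square. *)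
Definition torus_int (w1 w2 : R * R) (f : R -> R -> R) : R :=
  Rabs (det2 w1 w2) *
  RInt (fun s =>
    RInt (fun t => f (s * fst w1 + t * fst w2) (s * snd w1 + t * snd w2))
      0 1) 0 1.

Definition torus_intC (w1 w2 : R * R) (f : R -> R -> C) : C :=
  (torus_int w1 w2 (fun x y => Re (f x y)),
   torus_int w1 w2 (fun x y => Im (f x y))).

(** * Surfaces in a Riemannian metric on C^2 = R^4 *)

(* [g w a b] is the scalar product of the tangent vectors a, b at w;
   [G w a b] is the R-bilinear Christoffel map at w, so that the covariant
   derivative of a vector field Y in the direction a is D_a Y + G w a (Y w). *)
Definition metric : Type := C2 -> C2 -> C2 -> R.
Definition christoffel : Type := C2 -> C2 -> C2 -> C2.

Record levi_civita (g : metric) (G : christoffel) : Prop := {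
  lc_add : forall w a b c : C2, G w (add2 a b) c = add2 (G w a c) (G w b c);
  lc_scal : forall (w : C2) (t : R) (a c : C2),
    G w (scal2 t a) c = scal2 t (G w a c);
  lc_torsion_free : forall w a b : C2, G w a b = G w b a;
  lc_metric : forall w a b c : C2,
    is_derive (fun t : R => g (add2 w (scal2 t a)) b c) 0
      (g w (G w a b) c + g w b (G w a c))
}.

Section Surface.

Variables (g : metric) (G : christoffel) (F : R -> R -> C2) (x y : R).

Let Fx : C2 := partial2 1 0 F x y.
Let Fy : C2 := partial2 0 1 F x y.

Definition ff_xx : R := g (F x y) Fx Fx.
Definition ff_xy : R := g (F x y) Fx Fy.
Definition ff_yy : R := g (F x y) Fy Fy.
Definition ff_det : R := ff_xx * ff_yy - ff_xy * ff_xy.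

Definition area_density : R := sqrt ff_det.

Definition tangent_part (X : C2) : C2 :=
  add2
    (scal2 ((ff_yy * g (F x y) X Fx - ff_xy * g (F x y) X Fy) / ff_det) Fx)
    (scal2 ((ff_xx * g (F x y) X Fy - ff_xy * g (F x y) X Fx) / ff_det) Fy).

Definition normal_part (X : C2) : C2 := sub2 X (tangent_part X).

Definition sff_xx : C2 :=
  normal_part (add2 (partial2 2 0 F x y) (G (F x y) Fx Fx)).
Definition sff_xy : C2 :=
  normal_part (add2 (partial2 1 1 F x y) (G (F x y) Fx Fy)).
Definition sff_yy : C2 :=
  normal_part (add2 (partial2 0 2 F x y) (G (F x y) Fy Fy)).

(* Trace of the second fundamental form with respect to the first. *)
Definition mean_curvature : C2 :=
  add2 (scal2 (ff_yy / ff_det) sff_xx)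
    (add2 (scal2 (- 2 * ff_xy / ff_det) sff_xy)
          (scal2 (ff_xx / ff_det) sff_yy)).

Definition mean_curvature_sq : R :=
  g (F x y) mean_curvature mean_curvature.

End Surface.

(** * The complex projective plane *)

Inductive chart : Set := Ch0 | Ch1 | Ch2.

Definition chart_coord (k : chart) (z : C3) : C :=
  match k with Ch0 => c0 z | Ch1 => c1 z | Ch2 => c2 z end.

(* The affine chart {z_k <> 0} -> C^2, composed with the Hopf projection. *)
Definition hopf_in_chart (k : chart) (z : C3) : C2 :=
  match k with
  | Ch0 => (c1 z / c0 z, c2 z / c0 z)%C
  | Ch1 => (c2 z / c1 z, c0 z / c1 z)%C
  | Ch2 => (c0 z / c2 z, c1 z / c2 z)%C
  end.

Definition same_hopf (z z' : C3) : Prop :=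
  exists c : C, Cmod c = 1 /\ z' = scale3 c z.

(* The Fubini-Study metric has the same expression in the three charts; the
   normalisation is that of [hopf_riemannian_submersion]. *)
Definition fubini_study : metric := fun w a b =>
  Re (((1 + herm2 w w) * herm2 a b - herm2 a w * herm2 w b)
      / ((1 + herm2 w w) * (1 + herm2 w w)))%C.

Definition add3 (a b : C3) : C3 := (c0 a + c0 b, c1 a + c1 b, c2 a + c2 b)%C.

(* The differential at z of the Hopf projection read in a chart. *)
Definition hopf_push (k : chart) (z u : C3) : C2 :=
  partial2 1 0 (fun t _ => hopf_in_chart k (add3 z (scale3 (RtoC t) u))) 0 0.

Lemma is_derive_quot (p q u v : C) : q <> RtoC 0 ->
  partialC 1 0 (fun t _ => (p + RtoC t * u) / (q + RtoC t * v))%C 0 0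
  = ((u * q - p * v) / (q * q))%C.
Proof.
destruct p as [p1 p2], q as [q1 q2], u as [u1 u2], v as [v1 v2]; intros Hq.
assert (Hn : q1 ^ 2 + q2 ^ 2 <> 0).
{ intros E; apply Hq. assert (q1 = 0) by nra. assert (q2 = 0) by nra. subst; reflexivity. }
unfold partialC, partial_derive, Derive_n, Re, Im, RtoC, Cminus, Cdiv, Cinv, Cmult, Cplus, Copp; cbn [fst snd].
apply injective_projections; cbn [fst snd]; apply is_derive_unique; auto_derive;
  try (repeat split; contradict Hn; rewrite <- Hn; ring);
  field; split;
  [ replace (_ + _) with ((q1 ^ 2 + q2 ^ 2) ^ 2) by ring; now apply pow_nonzero
  | contradict Hn; rewrite <- Hn; ring
  | replace (_ + _) with ((q1 ^ 2 + q2 ^ 2) ^ 2) by ring; now apply pow_nonzero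
  | contradict Hn; rewrite <- Hn; ring].
Qed.

Lemma hopf_riemannian_submersion (k : chart) (z u u' : C3) :
  chart_coord k z <> RtoC 0 -> herm z z = RtoC 1 ->
  herm u z = RtoC 0 -> herm u' z = RtoC 0 ->
  fubini_study (hopf_in_chart k z) (hopf_push k z u) (hopf_push k z u')
  = Re (herm u u').
Proof.
intros Hk Hz Hu Hu'.
assert (Hzu' : herm z u' = RtoC 0).
{ replace (herm z u') with (Cconj (herm u' z)) by (apply injective_projections; unfold herm; simpl; ring).
  rewrite Hu'. apply injective_projections; simpl; ring. }
assert (E : herm u u' = ((herm z z * herm u u' - herm u z * herm z u') / (herm z z * herm z z))%C).
{ rewrite Hu, Hz, Hzu'. field; intros A; injection A; lra. }
assert (Hz0 : herm z z <> RtoC 0).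
{ rewrite Hz. intros A. injection A. lra. }
rewrite E. unfold fubini_study, hopf_push. f_equal.
clear Hu Hu' Hzu' E Hz.
destruct z as [[z0 z1] z2], u as [[u0 u1] u2], u' as [[x0 x1] x2].
assert (Cc : forall c : C, c <> RtoC 0 -> Cconj c <> RtoC 0).
{ intros [c d] Hc A. apply Hc. injection A. intros. apply injective_projections; simpl; lra. }
destruct k; unfold partial2, hopf_in_chart, add3, scale3, c0, c1, c2; cbn [fst snd];
  simpl in Hk; unfold c0, c1, c2 in Hk; simpl in Hk;
  rewrite !is_derive_quot by exact Hk; unfold herm2, herm, c0, c1, c2 in *; cbn [fst snd] in *;
  unfold Cdiv;
  repeat first [ rewrite Cmult_conj | rewrite Cminus_conj | rewrite Cplus_conj
    | rewrite Cinv_conj by (try apply Cmult_neq_0; exact Hk) ];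
  assert (Hk' := Cc _ Hk);
  field; repeat split; auto; (intros A; apply Hz0; rewrite <- A; ring).
Qed.

Definition fs_den (w : C2) : R := 1 + Re (herm2 w w).

Lemma fs_den_pos w : 0 < fs_den w.
Proof. destruct w as [[w1 w2] [w3 w4]]. unfold fs_den, herm2, Re; simpl. nra. Qed.

Lemma fubini_study_re w a b : fubini_study w a b =
  (fs_den w * Re (herm2 a b)
   - (Re (herm2 a w) * Re (herm2 b w) + Im (herm2 a w) * Im (herm2 b w)))
  / fs_den w ^ 2.
Proof.
assert (H := fs_den_pos w); unfold fubini_study.
assert (E : (1 + herm2 w w)%C = RtoC (fs_den w)).
{ destruct w as [[w1 w2] [w3 w4]].
  apply injective_projections; unfold fs_den, herm2, Re; simpl; ring. }
rewrite E, <- RtoC_mult; unfold Cdiv; rewrite <- RtoC_inv by nra.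
destruct w as [[w1 w2] [w3 w4]], a as [[a1 a2] [a3 a4]], b as [[b1 b2] [b3 b4]].
unfold Re, Im, herm2; simpl; field; lra.
Qed.

Definition fs_christoffel : christoffel := fun w a b =>
  add2 (scal2 (- / fs_den w) (fst a * herm2 b w, snd a * herm2 b w)%C)
       (scal2 (- / fs_den w) (fst b * herm2 a w, snd b * herm2 a w)%C).

Lemma fs_levi_civita : levi_civita fubini_study fs_christoffel.
Proof.
split.
- intros w a b c; unfold fs_christoffel, add2, scal2, herm2; simpl; f_equal; ring.
- intros w t a c; unfold fs_christoffel, add2, scal2, herm2; simpl; f_equal; ring.
- intros w a b; unfold fs_christoffel, add2, scal2; simpl; f_equal; ring.
- intros w a b c; assert (H := fs_den_pos w).
  assert (Ere : forall t e, Re (herm2 e (add2 w (scal2 t a)))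
    = Re (herm2 e w) + t * Re (herm2 e a))
    by (intros; unfold Re, herm2; simpl; ring).
  assert (Eim : forall t e, Im (herm2 e (add2 w (scal2 t a)))
    = Im (herm2 e w) + t * Im (herm2 e a))
    by (intros; unfold Im, herm2; simpl; ring).
  assert (Eq : forall t, fs_den (add2 w (scal2 t a))
    = fs_den w + 2 * t * Re (herm2 a w) + t ^ 2 * Re (herm2 a a))
    by (intros; unfold fs_den, Re, herm2; simpl; ring).
  assert (G2 : forall d e f, herm2 (fs_christoffel w d e) f =
     (RtoC (- / fs_den w) * (herm2 d f * herm2 e w + herm2 e f * herm2 d w))%C).
  { intros; unfold fs_christoffel, herm2, add2, scal2; simpl fst; simpl snd. ring. }
  assert (S : forall d e, herm2 d e = Cconj (herm2 e d)).
  { intros; apply injective_projections; unfold herm2; simpl; ring. }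
  apply is_derive_ext with (fun t : R =>
    ((fs_den w + 2 * t * Re (herm2 a w) + t ^ 2 * Re (herm2 a a)) * Re (herm2 b c)
     - ((Re (herm2 b w) + t * Re (herm2 b a)) * (Re (herm2 c w) + t * Re (herm2 c a))
        + (Im (herm2 b w) + t * Im (herm2 b a)) * (Im (herm2 c w) + t * Im (herm2 c a))))
    / (fs_den w + 2 * t * Re (herm2 a w) + t ^ 2 * Re (herm2 a a)) ^ 2).
  { intros t; rewrite fubini_study_re, Eq, !Ere, !Eim; reflexivity. }
  rewrite !fubini_study_re.
  rewrite (S b (fs_christoffel w a c)), !G2.
  rewrite (S a c), (S b a), (S b c).
  destruct (herm2 a w) as [x1 y1], (herm2 b w) as [x2 y2], (herm2 c w) as [x3 y3],
   (herm2 a b) as [x4 y4],  (herm2 c a) as [x5 y5], (herm2 c b) as [x6 y6].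
  generalize (Re (herm2 a a)); intros n.
  unfold Re, Im, Cconj, Cmult, Cplus, RtoC; cbn [fst snd].
  auto_derive.
  + apply Rgt_not_eq; ring_simplify; nra.
  + field; lra.
Qed.

(** * Lagrangian tori and their energy *)

Record lagrangian_torus
    (r : R -> R -> C3) (v : R -> R -> R) (w1 w2 : R * R) : Prop := {
  lt_lattice : det2 w1 w2 <> 0;
  lt_smooth_r : smooth3 r;
  lt_smooth_v : smooth2 v;
  lt_sphere : forall x y : R, herm (r x y) (r x y) = RtoC 1;
  lt_horizontal_x : forall x y : R,
    herm (partial3 1 0 r x y) (r x y) = RtoC 0;
  lt_horizontal_y : forall x y : R,
    herm (partial3 0 1 r x y) (r x y) = RtoC 0;
  lt_lagrangian : forall x y : R,
    herm (partial3 1 0 r x y) (partial3 0 1 r x y) = RtoC 0;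
  lt_conformal_x : forall x y : R,
    herm (partial3 1 0 r x y) (partial3 1 0 r x y) = RtoC (2 * exp (v x y));
  lt_conformal_y : forall x y : R,
    herm (partial3 0 1 r x y) (partial3 0 1 r x y) = RtoC (2 * exp (v x y));
  lt_periodic : forall l : R * R, in_lattice w1 w2 l ->
    forall x y : R, same_hopf (r x y) (r (x + fst l) (y + snd l))
}.

Record lagrangian_angle (r : R -> R -> C3) (beta : R -> R -> R) : Prop := {
  la_smooth : smooth2 beta;
  la_det : forall x y : R,
    ((cos (beta x y), sin (beta x y)) : C) =
    det3 (r x y)
      (scale3 (RtoC (/ norm3 (partial3 1 0 r x y))) (partial3 1 0 r x y))
      (scale3 (RtoC (/ norm3 (partial3 0 1 r x y))) (partial3 0 1 r x y))
}.

Definition potential (v beta : R -> R -> R) (x y : R) : C :=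
  (RtoC (4 * exp (v x y))
   + RtoC (/ 4 * (partial_derive 1 0 beta x y ^ 2
                  + partial_derive 0 1 beta x y ^ 2))
   + Ci / RtoC 2 * RtoC (partial_derive 2 0 beta x y
                         + partial_derive 0 2 beta x y))%C.

Definition energy (v beta : R -> R -> R) (w1 w2 : R * R) : C :=
  (RtoC (/ 2) * torus_intC w1 w2 (potential v beta))%C.

(* Main.v *)
(* The Hopf projection sends the second derivative of a horizontal curve in the
   sphere to its covariant derivative in CP^2 (the Christoffel terms cancel exactly
   the second-order terms of the affine chart), so the mean curvature vector is the
   projection of the normal component of (r_xx + r_yy) / (2 e^v).  Expanding in the
   unitary frame r, r_x/|r_x|, r_y/|r_y| and differentiating its determinant
   e^{i beta} gives H = J grad beta, whence
   |H|^2 dsigma = (beta_x^2 + beta_y^2) dx dy.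
   It remains to see that Delta beta integrates to 0.  If r(p + l) = c(p) r(p), then
   horizontality of r forces dc = 0; hence e^{i beta} is multiplied by the constant
   c^3 under the translation by l, so grad beta is doubly periodic and the divergence
   theorem applies. *)

From Stdlib Require Import Reals Lra.
From Coquelicot Require Import Coquelicot.
Require Import Defs.
Open Scope R_scope.

(** * Calculus of curves in C and C^3 *)

(** The connection [G] is given only by the axioms of [levi_civita]; Koszul's formula and the
    definiteness of the metric identify it with the explicit [fs_christoffel]. One affine chart may
    fail to contain the whole torus, so the geometry is computed at one point, in a chart valid near
    it, and only the resulting chart-free functions of [v] and [beta] are integrated. The identity H
    = J grad beta rests on two facts. The logarithmic derivative of a determinant is a trace, so 2
    e^v beta_x = Im <r_xx, r_x> + Im <r_xy, r_y>; differentiating the Lagrangian condition trades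
    the mixed term for Im <r_yy, r_x>, which leaves Im <r_xx + r_yy, r_x>. On the other side, the
    normal space of a Lagrangian plane is i times its tangent space, so taking the normal part in
    the frame keeps exactly the imaginary parts of these same products. *)

(** Real and imaginary parts are kept apart to match [partialC], which is built from real partial
    derivatives. *)
Definition is_deriveC (f : R -> C) (t : R) (l : C) : Prop :=
  is_derive (fun s => Re (f s)) t (Re l) /\ is_derive (fun s => Im (f s)) t (Im l).

Lemma is_deriveC_ext (f g : R -> C) (t : R) (l : C) :
  (forall s, f s = g s) -> is_deriveC f t l -> is_deriveC g t l.
Proof.
intros E [H1 H2]; split; [eapply is_derive_ext, H1 | eapply is_derive_ext, H2];
  intros s; simpl; now rewrite E.
Qed.

Lemma is_deriveC_unique (f : R -> C) (t : R) (l l' : C) :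
  is_deriveC f t l -> is_deriveC f t l' -> l = l'.
Proof.
intros [H1 H2] [H1' H2']; apply is_derive_unique in H1, H2, H1', H2'.
apply injective_projections; unfold Re, Im in *; congruence.
Qed.

Lemma is_deriveC_const (c : C) (t : R) : is_deriveC (fun _ => c) t 0.
Proof. split; exact (is_derive_const _ _). Qed.

Lemma is_deriveC_real (f : R -> R) (t l : R) :
  is_derive f t l -> is_deriveC (fun s => RtoC (f s)) t l.
Proof. intros H; split; [exact H | exact (is_derive_const _ _)]. Qed.

Lemma is_deriveC_conj (f : R -> C) (t : R) (l : C) :
  is_deriveC f t l -> is_deriveC (fun s => Cconj (f s)) t (Cconj l).
Proof. intros [H1 H2]; split; [exact H1 | exact (is_derive_opp _ _ _ H2)]. Qed.

Lemma is_deriveC_plus (f g : R -> C) (t : R) (l m : C) :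
  is_deriveC f t l -> is_deriveC g t m ->
  is_deriveC (fun s => f s + g s)%C t (l + m)%C.
Proof.
intros [H1 H2] [H3 H4]; split;
  [exact (is_derive_plus _ _ _ _ _ H1 H3) | exact (is_derive_plus _ _ _ _ _ H2 H4)].
Qed.

Lemma is_deriveC_minus (f g : R -> C) (t : R) (l m : C) :
  is_deriveC f t l -> is_deriveC g t m ->
  is_deriveC (fun s => f s - g s)%C t (l - m)%C.
Proof.
intros [H1 H2] [H3 H4]; split;
  [exact (is_derive_minus _ _ _ _ _ H1 H3) | exact (is_derive_minus _ _ _ _ _ H2 H4)].
Qed.

Lemma is_deriveC_mult (f g : R -> C) (t : R) (l m : C) :
  is_deriveC f t l -> is_deriveC g t m ->
  is_deriveC (fun s => f s * g s)%C t (l * g t + f t * m)%C.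
Proof.
intros [H1 H2] [H3 H4].
assert (M : forall (a b : R -> R) da db, is_derive a t da -> is_derive b t db ->
  is_derive (fun s => a s * b s) t (da * b t + a t * db)).
{ intros a b da db Ha Hb; exact (is_derive_mult a b t da db Ha Hb Rmult_comm). }
split.
- replace (Re _) with ((Re l * Re (g t) + Re (f t) * Re m)
    - (Im l * Im (g t) + Im (f t) * Im m)) by (unfold Re, Im; simpl; ring).
  exact (is_derive_minus _ _ _ _ _ (M _ _ _ _ H1 H3) (M _ _ _ _ H2 H4)).
- replace (Im _) with ((Re l * Im (g t) + Re (f t) * Im m)
    + (Im l * Re (g t) + Im (f t) * Re m)) by (unfold Re, Im; simpl; ring).
  exact (is_derive_plus _ _ _ _ _ (M _ _ _ _ H1 H4) (M _ _ _ _ H2 H3)).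
Qed.

(** Both parts of 1/f have this shape: the real part with (a, b) = (Re f, Im f), the imaginary part
    with (a, b) = (- Im f, Re f). *)
Lemma is_derive_div_sq_norm (a b : R -> R) (t da db : R) : a t ^ 2 + b t ^ 2 <> 0 ->
  is_derive a t da -> is_derive b t db ->
  is_derive (fun s => a s / (a s ^ 2 + b s ^ 2)) t
   ((da * (b t ^ 2 - a t ^ 2) - 2 * a t * b t * db) / (a t ^ 2 + b t ^ 2) ^ 2).
Proof.
intros Hn Ha Hb.
assert (E1 := is_derive_unique _ _ _ Ha); assert (E2 := is_derive_unique _ _ _ Hb).
assert (Hn' : a t * (a t * 1) + b t * (b t * 1) <> 0) by (contradict Hn; rewrite <- Hn; ring).
auto_derive.
- repeat split; auto; eexists; eassumption.
- change (fun x => a x) with a; change (fun x => b x) with b; rewrite E1, E2.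
  field; auto.
Qed.

Lemma is_deriveC_inv (f : R -> C) (t : R) (l : C) :
  f t <> 0 -> is_deriveC f t l -> is_deriveC (fun s => / f s)%C t (- (l / (f t * f t)))%C.
Proof.
intros Hf [H1 H2].
assert (Hn : Re (f t) ^ 2 + Im (f t) ^ 2 <> 0).
{ intros A; apply Hf. assert (Re (f t) = 0) by nra. assert (Im (f t) = 0) by nra.
  now apply injective_projections. }
assert (Hn2 : (fst (f t) * fst (f t) - snd (f t) * snd (f t)) ^ 2
  + (fst (f t) * snd (f t) + snd (f t) * fst (f t)) ^ 2 <> 0).
{ replace (_ + _) with ((Re (f t) ^ 2 + Im (f t) ^ 2) ^ 2) by (unfold Re, Im; ring).
  now apply pow_nonzero. }
split.
- evar_last; [exact (is_derive_div_sq_norm _ _ _ _ _ Hn H1 H2) | ].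
  revert Hn Hn2; unfold Re, Im; simpl; intros; field; split; intros A; [apply Hn2 | apply Hn]; rewrite <- A; ring.
- assert (H2' := is_derive_opp _ _ _ H2).
  assert (Hn' : (- Im (f t)) ^ 2 + Re (f t) ^ 2 <> 0)
    by (intros A; apply Hn; rewrite <- A; ring).
  evar_last.
  + eapply is_derive_ext; [ | exact (is_derive_div_sq_norm _ _ _ _ _ Hn' H2' H1)].
    intros s; unfold Re, Im, opp; simpl; f_equal; ring.
  + revert Hn Hn2 Hn'; unfold Re, Im, opp; simpl; intros; field; split; intros A; [apply Hn2 | apply Hn]; rewrite <- A; ring.
Qed.

Lemma is_deriveC_div (f g : R -> C) (t : R) (l m : C) :
  g t <> 0 -> is_deriveC f t l -> is_deriveC g t m ->
  is_deriveC (fun s => f s / g s)%C t ((l * g t - f t * m) / (g t * g t))%C.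
Proof.
intros Hg Hf Hm.
replace ((l * g t - f t * m) / (g t * g t))%C
  with (l * / g t + f t * - (m / (g t * g t)))%C by (field; auto).
apply is_deriveC_mult; [ | apply is_deriveC_inv]; auto.
Qed.

Definition is_derive2 (f : R -> C2) (t : R) (l : C2) : Prop :=
  is_deriveC (fun s => fst (f s)) t (fst l) /\ is_deriveC (fun s => snd (f s)) t (snd l).

Definition is_derive3 (f : R -> C3) (t : R) (l : C3) : Prop :=
  is_deriveC (fun s => c0 (f s)) t (c0 l) /\ is_deriveC (fun s => c1 (f s)) t (c1 l) /\
  is_deriveC (fun s => c2 (f s)) t (c2 l).

Lemma is_derive3_unique (f : R -> C3) (t : R) (l l' : C3) :
  is_derive3 f t l -> is_derive3 f t l' -> l = l'.
Proof.
destruct l as [[a b] c], l' as [[a' b'] c']; intros (H1 & H2 & H3) (H1' & H2' & H3').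
f_equal; [f_equal|]; eapply is_deriveC_unique; eassumption.
Qed.

Lemma is_derive3_ext (f g : R -> C3) (t : R) (l : C3) :
  (forall s, f s = g s) -> is_derive3 f t l -> is_derive3 g t l.
Proof.
intros E (H1 & H2 & H3); split; [|split];
  (eapply is_deriveC_ext; [|eassumption]); intros s; simpl; now rewrite E.
Qed.

Lemma is_derive3_scale (c : C) (f : R -> C3) (t : R) (l : C3) :
  is_derive3 f t l -> is_derive3 (fun s => scale3 c (f s)) t (scale3 c l).
Proof.
assert (A : forall (g : R -> C) m, is_deriveC g t m ->
  is_deriveC (fun s => c * g s)%C t (c * m)%C).
{ intros g m Hg.
  replace (c * m)%C with (0 * g t + c * m)%C by ring.
  exact (is_deriveC_mult _ _ _ _ _ (is_deriveC_const c t) Hg). }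
intros (H1 & H2 & H3); split; [|split]; apply A; assumption.
Qed.

Lemma is_deriveC_herm (f g : R -> C3) (t : R) (l m : C3) :
  is_derive3 f t l -> is_derive3 g t m ->
  is_deriveC (fun s => herm (f s) (g s)) t (herm l (g t) + herm (f t) m)%C.
Proof.
intros (F0 & F1 & F2) (G0 & G1 & G2); unfold herm.
match goal with |- is_deriveC _ _ ?L =>
  replace L with
  (((c0 l * Cconj (c0 (g t)) + c0 (f t) * Cconj (c0 m))
  + (c1 l * Cconj (c1 (g t)) + c1 (f t) * Cconj (c1 m)))
  + (c2 l * Cconj (c2 (g t)) + c2 (f t) * Cconj (c2 m)))%C by ring end.
exact (is_deriveC_plus _ _ _ _ _ (is_deriveC_plus _ _ _ _ _
  (is_deriveC_mult _ _ _ _ _ F0 (is_deriveC_conj _ _ _ G0))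
  (is_deriveC_mult _ _ _ _ _ F1 (is_deriveC_conj _ _ _ G1)))
  (is_deriveC_mult _ _ _ _ _ F2 (is_deriveC_conj _ _ _ G2))).
Qed.

Lemma is_deriveC_det3 (f g h : R -> C3) (t : R) (l m n : C3) :
  is_derive3 f t l -> is_derive3 g t m -> is_derive3 h t n ->
  is_deriveC (fun s => det3 (f s) (g s) (h s)) t
    (det3 l (g t) (h t) + det3 (f t) m (h t) + det3 (f t) (g t) n)%C.
Proof.
intros (F0 & F1 & F2) (G0 & G1 & G2) (H0 & H1 & H2); unfold det3.
assert (M := fun (a b c d p : R -> C) la lb lc ld lp
    (Ha : is_deriveC a t la) (Hb : is_deriveC b t lb) (Hc : is_deriveC c t lc)
    (Hd : is_deriveC d t ld) (Hp : is_deriveC p t lp) =>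
  is_deriveC_mult _ _ _ _ _ Hp (is_deriveC_minus _ _ _ _ _
    (is_deriveC_mult _ _ _ _ _ Ha Hb) (is_deriveC_mult _ _ _ _ _ Hc Hd))).
assert (D := is_deriveC_plus _ _ _ _ _ (is_deriveC_minus _ _ _ _ _
  (M _ _ _ _ _ _ _ _ _ _ G1 H2 G2 H1 F0) (M _ _ _ _ _ _ _ _ _ _ G0 H2 G2 H0 F1))
  (M _ _ _ _ _ _ _ _ _ _ G0 H1 G1 H0 F2)).
match type of D with is_deriveC _ _ ?e =>
  match goal with |- is_deriveC _ _ ?L => replace L with e by ring end end.
exact D.
Qed.

(** * Smooth maps on the plane and their partial derivatives *)

Lemma smooth2_continuous (f : R -> R -> R) x y : smooth2 f -> continuity_2d_pt f x y.
Proof. intros H; exact (proj1 (H 0%nat x y)). Qed.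

Lemma smooth2_derive_x (f : R -> R -> R) x y : smooth2 f ->
  is_derive (fun s => f s y) x (partial_derive 1 0 f x y).
Proof. intros H; apply Derive_correct. exact (proj1 (proj2 (H 1%nat x y))). Qed.

Lemma smooth2_derive_y (f : R -> R -> R) x y : smooth2 f ->
  is_derive (fun t => f x t) y (partial_derive 0 1 f x y).
Proof. intros H; apply Derive_correct. exact (proj1 (proj2 (proj2 (H 1%nat x y)))). Qed.

Lemma smooth2_partial_x (f : R -> R -> R) : smooth2 f -> smooth2 (partial_derive 1 0 f).
Proof. intros H n x y. exact (proj1 (proj2 (proj2 (proj2 (H (S n) x y))))). Qed.

Lemma smooth2_partial_y (f : R -> R -> R) : smooth2 f -> smooth2 (partial_derive 0 1 f).
Proof. intros H n x y. exact (proj2 (proj2 (proj2 (proj2 (H (S n) x y))))). Qed.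

(** [partial_derive 1 1] differentiates in y first, whereas differentiating r_x along y produces the
    other order. *)
Lemma smooth2_schwarz (f : R -> R -> R) x y : smooth2 f ->
  partial_derive 0 1 (partial_derive 1 0 f) x y = partial_derive 1 1 f x y.
Proof.
intros H; symmetry; apply (Schwarz f).
- exists (mkposreal _ Rlt_0_1); intros u v _ _.
  repeat split.
  + exact (ex_intro _ _ (smooth2_derive_x f u v H)).
  + exact (ex_intro _ _ (smooth2_derive_y f u v H)).
  + exact (ex_intro _ _ (smooth2_derive_x _ u v (smooth2_partial_y f H))).
  + exact (ex_intro _ _ (smooth2_derive_y _ u v (smooth2_partial_x f H))).
- exact (smooth2_continuous _ _ _ (smooth2_partial_x _ (smooth2_partial_y _ H))).
- exact (smooth2_continuous _ _ _ (smooth2_partial_y _ (smooth2_partial_x _ H))).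
Qed.

Lemma smooth2_derive_y_partial_x (f : R -> R -> R) x y : smooth2 f ->
  is_derive (fun t => partial_derive 1 0 f x t) y (partial_derive 1 1 f x y).
Proof.
intros H; rewrite <- smooth2_schwarz by exact H.
exact (smooth2_derive_y _ _ _ (smooth2_partial_x f H)).
Qed.

Lemma smooth3_derive_x (r : R -> R -> C3) x y :
  smooth3 r -> is_derive3 (fun s => r s y) x (partial3 1 0 r x y).
Proof.
intros ([A0 B0] & [A1 B1] & [A2 B2]).
exact (conj (conj (smooth2_derive_x _ _ _ A0) (smooth2_derive_x _ _ _ B0))
  (conj (conj (smooth2_derive_x _ _ _ A1) (smooth2_derive_x _ _ _ B1))
  (conj (smooth2_derive_x _ _ _ A2) (smooth2_derive_x _ _ _ B2)))).
Qed.

Lemma smooth3_derive_y (r : R -> R -> C3) x y :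
  smooth3 r -> is_derive3 (fun t => r x t) y (partial3 0 1 r x y).
Proof.
intros ([A0 B0] & [A1 B1] & [A2 B2]).
exact (conj (conj (smooth2_derive_y _ _ _ A0) (smooth2_derive_y _ _ _ B0))
  (conj (conj (smooth2_derive_y _ _ _ A1) (smooth2_derive_y _ _ _ B1))
  (conj (smooth2_derive_y _ _ _ A2) (smooth2_derive_y _ _ _ B2)))).
Qed.

Lemma smooth3_partial_x (r : R -> R -> C3) : smooth3 r -> smooth3 (partial3 1 0 r).
Proof.
intros ([A0 B0] & [A1 B1] & [A2 B2]).
exact (conj (conj (smooth2_partial_x _ A0) (smooth2_partial_x _ B0))
  (conj (conj (smooth2_partial_x _ A1) (smooth2_partial_x _ B1))
  (conj (smooth2_partial_x _ A2) (smooth2_partial_x _ B2)))).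
Qed.

Lemma smooth3_partial_y (r : R -> R -> C3) : smooth3 r -> smooth3 (partial3 0 1 r).
Proof.
intros ([A0 B0] & [A1 B1] & [A2 B2]).
exact (conj (conj (smooth2_partial_y _ A0) (smooth2_partial_y _ B0))
  (conj (conj (smooth2_partial_y _ A1) (smooth2_partial_y _ B1))
  (conj (smooth2_partial_y _ A2) (smooth2_partial_y _ B2)))).
Qed.

Lemma smooth3_derive_xx (r : R -> R -> C3) x y :
  smooth3 r -> is_derive3 (fun s => partial3 1 0 r s y) x (partial3 2 0 r x y).
Proof. intros H; exact (smooth3_derive_x _ x y (smooth3_partial_x r H)). Qed.

Lemma smooth3_derive_yy (r : R -> R -> C3) x y :
  smooth3 r -> is_derive3 (fun t => partial3 0 1 r x t) y (partial3 0 2 r x y).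
Proof. intros H; exact (smooth3_derive_y _ x y (smooth3_partial_y r H)). Qed.

Lemma smooth3_derive_yx (r : R -> R -> C3) x y :
  smooth3 r -> is_derive3 (fun s => partial3 0 1 r s y) x (partial3 1 1 r x y).
Proof. intros H; exact (smooth3_derive_x _ x y (smooth3_partial_y r H)). Qed.

Lemma smooth3_derive_xy (r : R -> R -> C3) x y :
  smooth3 r -> is_derive3 (fun t => partial3 1 0 r x t) y (partial3 1 1 r x y).
Proof.
intros ([A0 B0] & [A1 B1] & [A2 B2]).
pose (D := smooth2_derive_y_partial_x).
exact (conj (conj (D _ _ _ A0) (D _ _ _ B0))
  (conj (conj (D _ _ _ A1) (D _ _ _ B1)) (conj (D _ _ _ A2) (D _ _ _ B2)))).
Qed.

(** * The differential of the Hopf projection *)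

(* [hopf_push] as an explicit quotient, which unlike [Derive] can be differentiated again. *)
Definition hopf_diff (k : chart) (z u : C3) : C2 :=
  let d (p q u v : C) := ((u * q - p * v) / (q * q))%C in
  match k with
  | Ch0 => (d (c1 z) (c0 z) (c1 u) (c0 u), d (c2 z) (c0 z) (c2 u) (c0 u))
  | Ch1 => (d (c2 z) (c1 z) (c2 u) (c1 u), d (c0 z) (c1 z) (c0 u) (c1 u))
  | Ch2 => (d (c0 z) (c2 z) (c0 u) (c2 u), d (c1 z) (c2 z) (c1 u) (c2 u))
  end.

Lemma hopf_push_eq (k : chart) (z u : C3) :
  chart_coord k z <> 0 -> hopf_push k z u = hopf_diff k z u.
Proof. intros H; destruct k; apply (f_equal2 pair); exact (is_derive_quot _ _ _ _ H). Qed.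

Lemma is_derive2_hopf (k : chart) (z : R -> C3) (t : R) (u : C3) :
  chart_coord k (z t) <> 0 -> is_derive3 z t u ->
  is_derive2 (fun s => hopf_in_chart k (z s)) t (hopf_diff k (z t) u).
Proof.
intros H (D0 & D1 & D2);
destruct k; split; apply is_deriveC_div; assumption.
Qed.

(** The second derivative of p / q, arranged as the first-order expression applied to the
    accelerations minus a multiple of (p / q)'. The Christoffel term will cancel that multiple. *)
Lemma is_deriveC_quot_derive (p q p' q' : R -> C) (t : R) (p2 q2 : C) :
  q t <> 0 -> is_deriveC p t (p' t) -> is_deriveC q t (q' t) ->
  is_deriveC p' t p2 -> is_deriveC q' t q2 ->
  is_deriveC (fun s => (p' s * q s - p s * q' s) / (q s * q s))%C t
    ((p2 * q t - p t * q2) / (q t * q t)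
     - 2 * (q' t / q t) * ((p' t * q t - p t * q' t) / (q t * q t)))%C.
Proof.
intros H Hp Hq Hp' Hq'.
assert (D := is_deriveC_div _ _ _ _ _ (Cmult_neq_0 _ _ H H)
  (is_deriveC_minus _ _ _ _ _ (is_deriveC_mult _ _ _ _ _ Hp' Hq)
     (is_deriveC_mult _ _ _ _ _ Hp Hq'))
  (is_deriveC_mult _ _ _ _ _ Hq Hq)).
match type of D with is_deriveC _ _ ?e =>
  match goal with |- is_deriveC _ _ ?L => replace L with e by (field; auto) end end.
exact D.
Qed.

Lemma is_derive2_hopf_diff (k : chart) (z z' : R -> C3) (t : R) (z2 : C3) :
  chart_coord k (z t) <> 0 -> is_derive3 z t (z' t) -> is_derive3 z' t z2 ->
  is_derive2 (fun s => hopf_diff k (z s) (z' s)) t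
    (let a := (2 * (chart_coord k (z' t) / chart_coord k (z t)))%C in
     let d1 := hopf_diff k (z t) (z' t) in let d2 := hopf_diff k (z t) z2 in
     (fst d2 - a * fst d1, snd d2 - a * snd d1)%C).
Proof.
intros H (D0 & D1 & D2) (E0 & E1 & E2).
destruct k; split;
[ exact (is_deriveC_quot_derive _ _ (fun s => c1 (z' s)) (fun s => c0 (z' s)) _ _ _ H D1 D0 E1 E0)
| exact (is_deriveC_quot_derive _ _ (fun s => c2 (z' s)) (fun s => c0 (z' s)) _ _ _ H D2 D0 E2 E0)
| exact (is_deriveC_quot_derive _ _ (fun s => c2 (z' s)) (fun s => c1 (z' s)) _ _ _ H D2 D1 E2 E1)
| exact (is_deriveC_quot_derive _ _ (fun s => c0 (z' s)) (fun s => c1 (z' s)) _ _ _ H D0 D1 E0 E1)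
| exact (is_deriveC_quot_derive _ _ (fun s => c0 (z' s)) (fun s => c2 (z' s)) _ _ _ H D0 D2 E0 E2)
| exact (is_deriveC_quot_derive _ _ (fun s => c1 (z' s)) (fun s => c2 (z' s)) _ _ _ H D1 D2 E1 E2) ].
Qed.

Lemma Cconj_neq_0 (c : C) : c <> 0 -> Cconj c <> 0.
Proof.
intros H A; apply H; rewrite <- (Cconj_conj c), A.
apply injective_projections; simpl; ring.
Qed.

(** In the chart 1 + |w|^2 equals |z|^2 / |z_k|^2, and |z| = 1. *)
Lemma fs_den_hopf (k : chart) (z : C3) :
  chart_coord k z <> 0 -> herm z z = 1 ->
  RtoC (fs_den (hopf_in_chart k z)) = (/ (chart_coord k z * Cconj (chart_coord k z)))%C.
Proof.
intros H Hz; assert (H' := Cconj_neq_0 _ H).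
assert (E : forall w, RtoC (fs_den w) = (1 + herm2 w w)%C).
{ intros [[a b] [c d]]; apply injective_projections; unfold fs_den, herm2, Re; simpl; ring. }
transitivity (herm z z / (chart_coord k z * Cconj (chart_coord k z)))%C.
- rewrite E; unfold herm, herm2, hopf_in_chart.
  destruct k; simpl in *; unfold Cdiv; rewrite !Cmult_conj, !Cinv_conj by assumption;
    field; auto.
- rewrite Hz; field; auto.
Qed.

(** The components of the differential are u_j / z_k - z_j u_k / z_k^2, which vanishes for j = k.
    The product over the other two indices is therefore the full one, (<u, z> - (u_k / z_k) |z|^2) /
    |z_k|^2, where <u, z> = 0. *)
Lemma herm2_hopf_diff (k : chart) (z u : C3) :
  chart_coord k z <> 0 -> herm z z = 1 -> herm u z = 0 ->
  herm2 (hopf_diff k z u) (hopf_in_chart k z)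
  = (- (RtoC (fs_den (hopf_in_chart k z)) * (chart_coord k u / chart_coord k z)))%C.
Proof.
intros H Hz Hu.
assert (H' := Cconj_neq_0 _ H).
rewrite fs_den_hopf by assumption.
unfold herm in Hu, Hz.
destruct z as [[z0 z1] z2], u as [[u0 u1] u2].
unfold c0, c1, c2 in Hu, Hz; simpl in Hu, Hz.
destruct k; unfold herm2, hopf_diff, hopf_in_chart, c0, c1, c2 in *; simpl in *;
unfold c0, c1, c2 in *; simpl in *;
unfold Cdiv; rewrite !Cmult_conj, !Cinv_conj by assumption.
- transitivity ((z0 * (u0 * Cconj z0 + u1 * Cconj z1 + u2 * Cconj z2)
   - (u0 * (z0 * Cconj z0 + z1 * Cconj z1 + z2 * Cconj z2))) / (z0 * z0 * Cconj z0))%C.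
  + field; auto.
  + rewrite Hu, Hz; field; auto.
- transitivity ((z1 * (u0 * Cconj z0 + u1 * Cconj z1 + u2 * Cconj z2)
   - (u1 * (z0 * Cconj z0 + z1 * Cconj z1 + z2 * Cconj z2))) / (z1 * z1 * Cconj z1))%C.
  + field; auto.
  + rewrite Hu, Hz; field; auto.
- transitivity ((z2 * (u0 * Cconj z0 + u1 * Cconj z1 + u2 * Cconj z2)
   - (u2 * (z0 * Cconj z0 + z1 * Cconj z1 + z2 * Cconj z2))) / (z2 * z2 * Cconj z2))%C.
  + field; auto.
  + rewrite Hu, Hz; field; auto.
Qed.

(** On the diagonal [fs_christoffel] is - 2 <d, w> d divided by [fs_den w], and [herm2_hopf_diff]
    cancels that denominator. The result is the multiple of d subtracted in
    [is_derive2_hopf_diff]. *)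
Lemma fs_christoffel_hopf (k : chart) (z u : C3) :
  chart_coord k z <> 0 -> herm z z = 1 -> herm u z = 0 ->
  fs_christoffel (hopf_in_chart k z) (hopf_diff k z u) (hopf_diff k z u)
  = (let a := (2 * (chart_coord k u / chart_coord k z))%C in
     let d := hopf_diff k z u in (a * fst d, a * snd d)%C).
Proof.
intros H Hz Hu; unfold fs_christoffel.
assert (Hd := fs_den_pos (hopf_in_chart k z)).
rewrite herm2_hopf_diff by assumption.
assert (Hd' : RtoC (fs_den (hopf_in_chart k z)) <> 0) by (intros A; injection A; lra).
unfold add2, scal2; simpl fst; simpl snd.
rewrite RtoC_opp, RtoC_inv by lra.
f_equal; field; auto.
Qed.

(** * The Levi-Civita connection *)

(** The vectors are constant fields in the chart, so the brackets vanish and Koszul's formula has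
    only derivatives of the metric. The right-hand side does not mention [G]. *)
Lemma koszul (g : metric) (G : christoffel) (w a b c : C2) :
  (forall w u u', g w u u' = g w u' u) -> levi_civita g G ->
  let D a b c := Derive (fun t => g (add2 w (scal2 t a)) b c) 0 in
  g w (G w a b) c = (D a b c + D b c a - D c a b) / 2.
Proof.
intros S HG D.
assert (E : forall a b c, D a b c = g w (G w a b) c + g w (G w a c) b).
{ intros; rewrite (S w (G w a0 c0)); apply is_derive_unique, (lc_metric _ _ HG). }
rewrite !E, (lc_torsion_free _ _ HG w b c), (lc_torsion_free _ _ HG w c a),
  (lc_torsion_free _ _ HG w b a); lra.
Qed.

Lemma fubini_study_sym (w a b : C2) : fubini_study w a b = fubini_study w b a.
Proof. rewrite !fubini_study_re; f_equal; unfold herm2, Re, Im; simpl; ring. Qed.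

Lemma fubini_study_sub_l (w a b c : C2) :
  fubini_study w (sub2 a b) c = fubini_study w a c - fubini_study w b c.
Proof.
assert (H := fs_den_pos w).
rewrite !fubini_study_re; unfold sub2, add2, scal2, herm2, Re, Im; simpl; field; lra.
Qed.

Lemma fubini_study_definite (w a : C2) : fubini_study w a a = 0 -> a = (RtoC 0, RtoC 0).
Proof.
assert (H := fs_den_pos w).
rewrite fubini_study_re; intros A.
apply (f_equal (Rmult (fs_den w ^ 2))) in A.
rewrite Rmult_0_r in A; unfold Rdiv in A.
rewrite (Rmult_comm (_ - _)), <- Rmult_assoc, Rinv_r, Rmult_1_l in A by (apply pow_nonzero; lra).
revert A; clear H; destruct w as [[w1 w2] [w3 w4]], a as [[a1 a2] [a3 a4]].
unfold fs_den, herm2, Re, Im; simpl; intros A.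
(* Lagrange's identity: [|w|^2 |a|^2 - |<a, w>|^2 = |a_1 w_2 - a_2 w_1|^2] *)
assert (B : a1 ^ 2 + a2 ^ 2 + a3 ^ 2 + a4 ^ 2
  + ((a1 * w3 - a2 * w4 - a3 * w1 + a4 * w2) ^ 2
  + (a1 * w4 + a2 * w3 - a3 * w2 - a4 * w1) ^ 2) = 0) by (rewrite <- A; ring).
clear A.
assert (C1 := pow2_ge_0 (a1 * w3 - a2 * w4 - a3 * w1 + a4 * w2)).
assert (C2 := pow2_ge_0 (a1 * w4 + a2 * w3 - a3 * w2 - a4 * w1)).
assert (D1 := pow2_ge_0 a1); assert (D2 := pow2_ge_0 a2).
assert (D3 := pow2_ge_0 a3); assert (D4 := pow2_ge_0 a4).
assert (Z : forall x, x ^ 2 = 0 -> x = 0) by (intros; nra).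
unfold RtoC; repeat f_equal; apply Z; lra.
Qed.

(** By [koszul] the difference of the two connections has zero product with every vector, in
    particular with itself. *)
Lemma levi_civita_fubini_study_unique (G : christoffel) (w a b : C2) :
  levi_civita fubini_study G -> G w a b = fs_christoffel w a b.
Proof.
intros HG.
assert (A : sub2 (G w a b) (fs_christoffel w a b) = (RtoC 0, RtoC 0)).
{ apply (fubini_study_definite w); rewrite fubini_study_sub_l.
  rewrite (koszul _ _ _ _ _ _ fubini_study_sym HG).
  rewrite (koszul _ _ _ _ _ _ fubini_study_sym fs_levi_civita); lra. }
revert A; destruct (G w a b) as [[x1 x2] [x3 x4]], (fs_christoffel w a b) as [[y1 y2] [y3 y4]].
unfold sub2, add2, scal2; simpl; intros A; injection A; intros.
f_equal; apply injective_projections; simpl; lra.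
Qed.

(** The first derivative has to be known on a neighbourhood, not only at t: the Hopf projection read
    in a chart is controlled only where the chart coordinate does not vanish. *)
Lemma Derive_n_2 (f f' : R -> R) (t l : R) :
  locally t (fun s => is_derive f s (f' s)) -> is_derive f' t l -> Derive_n f 2 t = l.
Proof.
intros Hf Hf'; apply is_derive_unique.
apply (is_derive_ext_loc f'); [ | exact Hf'].
apply filter_imp with (2 := Hf); intros s Hs; symmetry; now apply is_derive_unique.
Qed.

Lemma partial2_1_0 (F : R -> R -> C2) (x y : R) (l : C2) :
  is_derive2 (fun s => F s y) x l -> partial2 1 0 F x y = l.
Proof.
intros ([H1 H2] & [H3 H4]).
apply injective_projections; apply injective_projections; apply is_derive_unique; assumption.
Qed.

Lemma partial2_0_1 (F : R -> R -> C2) (x y : R) (l : C2) :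
  is_derive2 (fun t => F x t) y l -> partial2 0 1 F x y = l.
Proof.
intros ([H1 H2] & [H3 H4]).
apply injective_projections; apply injective_projections; apply is_derive_unique; assumption.
Qed.

Lemma partial2_2_0 (F : R -> R -> C2) (f' : R -> C2) (x y : R) (l : C2) :
  locally x (fun s => is_derive2 (fun s => F s y) s (f' s)) -> is_derive2 f' x l ->
  partial2 2 0 F x y = l.
Proof.
intros H ([H1 H2] & [H3 H4]).
apply injective_projections; apply injective_projections;
  (eapply Derive_n_2; [ | eassumption]);
  (apply filter_imp with (2 := H); intros s ([A1 A2] & [A3 A4]); assumption).
Qed.

Lemma partial2_0_2 (F : R -> R -> C2) (f' : R -> C2) (x y : R) (l : C2) :
  locally y (fun t => is_derive2 (fun t => F x t) t (f' t)) -> is_derive2 f' y l ->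
  partial2 0 2 F x y = l.
Proof.
intros H ([H1 H2] & [H3 H4]).
apply injective_projections; apply injective_projections;
  (eapply Derive_n_2; [ | eassumption]);
  (apply filter_imp with (2 := H); intros s ([A1 A2] & [A3 A4]); assumption).
Qed.

(** This supplies the neighbourhood required by [Derive_n_2]. Nonvanishing of a complex coordinate
    is expressed by its squared modulus, a single continuous real function. *)
Lemma is_derive3_chart_neq_0 (k : chart) (z : R -> C3) (t : R) (u : C3) :
  chart_coord k (z t) <> 0 -> is_derive3 z t u ->
  locally t (fun s => chart_coord k (z s) <> 0).
Proof.
intros H Hz.
assert (D : is_deriveC (fun s => chart_coord k (z s)) t (chart_coord k u))
  by (destruct Hz as (D0 & D1 & D2); destruct k; assumption).
destruct D as [D1 D2].
assert (Q : continuous (fun s => Re (chart_coord k (z s)) ^ 2 + Im (chart_coord k (z s)) ^ 2) t)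
  by exact (ex_derive_continuous _ _ (ex_intro _ _
       (is_derive_plus _ _ _ _ _ (is_derive_pow _ 2 _ _ D1) (is_derive_pow _ 2 _ _ D2)))).
assert (P : Re (chart_coord k (z t)) ^ 2 + Im (chart_coord k (z t)) ^ 2 <> 0).
{ intros A; apply H; apply injective_projections; unfold Re, Im in A; simpl; nra. }
assert (L := Q (fun v : R => v <> 0) (open_neq 0 _ P)).
unfold filtermap in L; apply filter_imp with (2 := L).
intros s Hs A; apply Hs; rewrite A; simpl; ring.
Qed.

(** * Unitary frames and mean curvature *)

Lemma herm_conj (a b : C3) : Cconj (herm a b) = herm b a.
Proof. apply injective_projections; unfold herm; simpl; ring. Qed.

Lemma herm_eq_0_sym (a b : C3) : herm a b = 0 -> herm b a = 0.
Proof.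
intros H; rewrite <- herm_conj, H; apply injective_projections; simpl; ring.
Qed.

Lemma herm_add_l (a b c : C3) : herm (add3 a b) c = (herm a c + herm b c)%C.
Proof. unfold herm, add3, c0, c1, c2; simpl; ring. Qed.

Lemma herm_add_r (a b c : C3) : herm c (add3 a b) = (herm c a + herm c b)%C.
Proof. unfold herm, add3, c0, c1, c2; simpl; rewrite !Cplus_conj; ring. Qed.

Lemma herm_scale_l (c : C) (a b : C3) : herm (scale3 c a) b = (c * herm a b)%C.
Proof. unfold herm, scale3, c0, c1, c2; simpl; ring. Qed.

Lemma herm_scale_r (c : C) (a b : C3) : herm a (scale3 c b) = (Cconj c * herm a b)%C.
Proof. unfold herm, scale3, c0, c1, c2; simpl; rewrite !Cmult_conj; ring. Qed.

(** Cramer's rule: the three equations form a linear system for d whose matrix is the conjugate of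
    (a, b, c). Each [transitivity] below is a cofactor combination equal to one component of d times
    the conjugate determinant. *)
Lemma det3_orthogonal_eq_0 (a b c d : C3) : det3 a b c <> 0 ->
  herm d a = 0 -> herm d b = 0 -> herm d c = 0 -> d = (RtoC 0, RtoC 0, RtoC 0).
Proof.
intros H Ha Hb Hc; apply Cconj_neq_0 in H; unfold det3 in H.
repeat rewrite ?Cplus_conj, ?Cminus_conj, ?Cmult_conj in H.
unfold herm in *; destruct a as [[a0 a1] a2], b as [[b0 b1] b2], c as [[c_0 c_1] c_2],
  d as [[d0 d1] d2]; unfold c0, c1, c2 in *; simpl in *.
match type of H with ?D <> _ =>
  assert (Z : forall e, (e * D)%C = 0 -> e = 0)
  by (intros e He; destruct (Ceq_dec e 0) as [E|E]; auto;
      exfalso; exact (Cmult_neq_0 _ _ E H He)) end.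
repeat f_equal; apply Z; clear H Z.
- transitivity ((d0 * Cconj a0 + d1 * Cconj a1 + d2 * Cconj a2) * (Cconj b1 * Cconj c_2 - Cconj b2 * Cconj c_1)
   - (d0 * Cconj b0 + d1 * Cconj b1 + d2 * Cconj b2) * (Cconj a1 * Cconj c_2 - Cconj a2 * Cconj c_1)
   + (d0 * Cconj c_0 + d1 * Cconj c_1 + d2 * Cconj c_2) * (Cconj a1 * Cconj b2 - Cconj a2 * Cconj b1))%C;
  [ring | rewrite Ha, Hb, Hc; ring].
- transitivity (- (d0 * Cconj a0 + d1 * Cconj a1 + d2 * Cconj a2) * (Cconj b0 * Cconj c_2 - Cconj b2 * Cconj c_0)
   + (d0 * Cconj b0 + d1 * Cconj b1 + d2 * Cconj b2) * (Cconj a0 * Cconj c_2 - Cconj a2 * Cconj c_0)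
   - (d0 * Cconj c_0 + d1 * Cconj c_1 + d2 * Cconj c_2) * (Cconj a0 * Cconj b2 - Cconj a2 * Cconj b0))%C;
  [ring | rewrite Ha, Hb, Hc; ring].
- transitivity ((d0 * Cconj a0 + d1 * Cconj a1 + d2 * Cconj a2) * (Cconj b0 * Cconj c_1 - Cconj b1 * Cconj c_0)
   - (d0 * Cconj b0 + d1 * Cconj b1 + d2 * Cconj b2) * (Cconj a0 * Cconj c_1 - Cconj a1 * Cconj c_0)
   + (d0 * Cconj c_0 + d1 * Cconj c_1 + d2 * Cconj c_2) * (Cconj a0 * Cconj b1 - Cconj a1 * Cconj b0))%C;
  [ring | rewrite Ha, Hb, Hc; ring].
Qed.

Lemma add3_opp_eq_0 (u w : C3) :
  add3 u (scale3 (RtoC (-1)) w) = (RtoC 0, RtoC 0, RtoC 0) -> u = w.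
Proof.
destruct u as [[[u1 u2] [u3 u4]] [u5 u6]], w as [[[w1 w2] [w3 w4]] [w5 w6]].
unfold add3, scale3, c0, c1, c2; simpl; intros H; injection H; intros.
repeat (f_equal; try lra).
Qed.

Lemma hopf_diff_add (k : chart) (z u u' : C3) : chart_coord k z <> 0 ->
  hopf_diff k z (add3 u u') = add2 (hopf_diff k z u) (hopf_diff k z u').
Proof.
intros H; destruct z as [[z0 z1] z2], u as [[u0 u1] u2], u' as [[v0 v1] v2], k;
  unfold c0, c1, c2 in *; simpl in *;
  unfold hopf_diff, add2, add3, c0, c1, c2 in *; simpl in *; f_equal; field; auto.
Qed.

Lemma hopf_diff_scale (k : chart) (z u : C3) (c : C) : chart_coord k z <> 0 ->
  hopf_diff k z (scale3 c u)
  = (c * fst (hopf_diff k z u), c * snd (hopf_diff k z u))%C.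
Proof.
intros H; destruct z as [[z0 z1] z2], u as [[u0 u1] u2], k;
  unfold c0, c1, c2 in *; simpl in *;
  unfold hopf_diff, scale3, c0, c1, c2 in *; simpl in *; f_equal; field; auto.
Qed.

Lemma hopf_diff_self (k : chart) (z : C3) : chart_coord k z <> 0 ->
  hopf_diff k z z = (RtoC 0, RtoC 0).
Proof.
intros H; destruct z as [[z0 z1] z2], k;
  unfold c0, c1, c2 in *; simpl in *;
  unfold hopf_diff, c0, c1, c2 in *; simpl in *; f_equal; field; auto.
Qed.

(** The vectors r, r_x, r_y at a point, left unnormalised with E = 2 e^v; for the torus [fr_det]
    comes from the Lagrangian angle. *)
Record frame (E : R) (z a b : C3) : Prop := {
  fr_pos : 0 < E;
  fr_z : herm z z = 1;
  fr_az : herm a z = 0;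
  fr_bz : herm b z = 0;
  fr_ab : herm a b = 0;
  fr_a : herm a a = RtoC E;
  fr_b : herm b b = RtoC E;
  fr_det : det3 z a b <> 0
}.

Section Frame.

Variables (E : R) (z a b : C3).
Hypothesis Hf : frame E z a b.

Lemma frame_neq_0 : RtoC E <> 0.
Proof. intros A; injection A; generalize (fr_pos _ _ _ _ Hf); lra. Qed.

(** The difference of the two sides is orthogonal to z, a and b. *)
Lemma frame_decomposition (u : C3) :
  u = add3 (scale3 (herm u z) z)
        (add3 (scale3 (herm u a / E) a) (scale3 (herm u b / E) b)).
Proof.
assert (HE := frame_neq_0); destruct Hf as [_ Hz Haz Hbz Hab Ha Hb Hdet].
assert (Hza := herm_eq_0_sym _ _ Haz); assert (Hzb := herm_eq_0_sym _ _ Hbz).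
assert (Hba := herm_eq_0_sym _ _ Hab).
match goal with |- u = ?w => set (d := add3 u (scale3 (RtoC (-1)) w)) end.
assert (D : d = (RtoC 0, RtoC 0, RtoC 0)).
{ apply (det3_orthogonal_eq_0 _ _ _ d Hdet); unfold d;
    rewrite !herm_add_l, !herm_scale_l, !herm_add_l, !herm_scale_l,
      ?Hz, ?Haz, ?Hbz, ?Hza, ?Hzb, ?Hab, ?Hba, ?Ha, ?Hb; field; auto. }
exact (add3_opp_eq_0 _ _ D).
Qed.

(** By multilinearity only the component of u along the replaced vector survives. The three lemmas
    together turn the derivative of a determinant into a trace. *)
Lemma det3_frame_1 (u : C3) : det3 u a b = (herm u z * det3 z a b)%C.
Proof.
pattern u at 1; rewrite (frame_decomposition u).
unfold det3, add3, scale3, c0, c1, c2; simpl; ring.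
Qed.

Lemma det3_frame_2 (u : C3) : det3 z u b = (herm u a / E * det3 z a b)%C.
Proof.
pattern u at 1; rewrite (frame_decomposition u).
unfold det3, add3, scale3, c0, c1, c2; simpl; ring.
Qed.

Lemma det3_frame_3 (u : C3) : det3 z a u = (herm u b / E * det3 z a b)%C.
Proof.
pattern u at 1; rewrite (frame_decomposition u).
unfold det3, add3, scale3, c0, c1, c2; simpl; ring.
Qed.

Variable k : chart.
Hypothesis Hk : chart_coord k z <> 0.

Let A : C2 := hopf_diff k z a.
Let B : C2 := hopf_diff k z b.

(** The component along z lies in the kernel of the differential, by [hopf_diff_self]. *)
Lemma hopf_diff_frame (u : C3) :
  hopf_diff k z u = (herm u a / E * fst A + herm u b / E * fst B,
                     herm u a / E * snd A + herm u b / E * snd B)%C.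
Proof.
unfold A, B; rewrite (frame_decomposition u) at 1.
rewrite !hopf_diff_add, !hopf_diff_scale, hopf_diff_self by assumption.
unfold add2; simpl; f_equal; ring.
Qed.

(** Removing the vertical part of u changes neither its image nor its product with the horizontal v.
    So u may be an acceleration, which need not be horizontal. *)
Lemma fubini_study_hopf_diff (u v : C3) : herm v z = 0 ->
  fubini_study (hopf_in_chart k z) (hopf_diff k z u) (hopf_diff k z v) = Re (herm u v).
Proof.
intros Hv.
set (u' := add3 u (scale3 (- herm u z) z)).
assert (Hu : hopf_diff k z u = hopf_diff k z u').
{ unfold u'; rewrite hopf_diff_add, hopf_diff_scale, hopf_diff_self by assumption.
  unfold add2; simpl; apply injective_projections; simpl fst; simpl snd; ring. }
rewrite Hu, <- !hopf_push_eq by assumption.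
rewrite hopf_riemannian_submersion; auto; try apply Hf; unfold u'.
- f_equal; rewrite herm_add_l, herm_scale_l, (herm_eq_0_sym _ _ Hv); ring.
- rewrite herm_add_l, herm_scale_l, (fr_z _ _ _ _ Hf); ring.
Qed.

Variables (F : R -> R -> C2) (x y : R).
Hypotheses (HF : F x y = hopf_in_chart k z)
  (HFx : partial2 1 0 F x y = A) (HFy : partial2 0 1 F x y = B).

Lemma ff_xx_frame : ff_xx fubini_study F x y = E.
Proof.
unfold ff_xx; rewrite HF, HFx; unfold A.
rewrite fubini_study_hopf_diff, (fr_a _ _ _ _ Hf) by apply Hf; reflexivity.
Qed.

Lemma ff_yy_frame : ff_yy fubini_study F x y = E.
Proof.
unfold ff_yy; rewrite HF, HFy; unfold B.
rewrite fubini_study_hopf_diff, (fr_b _ _ _ _ Hf) by apply Hf; reflexivity.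
Qed.

Lemma ff_xy_frame : ff_xy fubini_study F x y = 0.
Proof.
unfold ff_xy; rewrite HF, HFx, HFy; unfold A, B.
rewrite fubini_study_hopf_diff, (fr_ab _ _ _ _ Hf) by apply Hf; reflexivity.
Qed.

Lemma area_density_frame : area_density fubini_study F x y = E.
Proof.
unfold area_density, ff_det; rewrite ff_xx_frame, ff_yy_frame, ff_xy_frame.
rewrite <- (sqrt_square E) at 3 by (generalize (fr_pos _ _ _ _ Hf); lra); f_equal; ring.
Qed.

(** The tangent plane is the real span of A and B, and its orthogonal complement is spanned by iA
    and iB because <a, b> = 0 and a, b have real squared norms. The projection thus drops the real
    parts of the complex coefficients. *)
Lemma normal_part_frame (u : C3) :
  normal_part fubini_study F x y (hopf_diff k z u) =
  (Ci * (Im (herm u a) / E)%R * fst A + Ci * (Im (herm u b) / E)%R * fst B,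
   Ci * (Im (herm u a) / E)%R * snd A + Ci * (Im (herm u b) / E)%R * snd B)%C.
Proof.
assert (HE := frame_neq_0).
unfold normal_part, tangent_part, ff_det.
rewrite ff_xx_frame, ff_yy_frame, ff_xy_frame, HF, HFx, HFy.
unfold A, B; rewrite !fubini_study_hopf_diff by apply Hf; rewrite (hopf_diff_frame u).
unfold A, B; unfold Cdiv; rewrite <- RtoC_inv by (generalize (fr_pos _ _ _ _ Hf); lra).
assert (HE' := fr_pos _ _ _ _ Hf); revert HE'; clear.
destruct (herm u a) as [p1 p2], (herm u b) as [q1 q2],
  (hopf_diff k z a) as [[a1 a2] [a3 a4]], (hopf_diff k z b) as [[b1 b2] [b3 b4]]; intros HE.
unfold sub2, add2, scal2; simpl.
f_equal; apply injective_projections; simpl; field; lra.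
Qed.

(** Here p and q are vectors of C^3 whose images are the covariant derivatives of the coordinate
    fields. One factor 1/E comes from the frame coefficients, the other from the trace; the mixed
    term has weight zero since [ff_xy] vanishes. *)
Lemma mean_curvature_frame (G : christoffel) (p q : C3) :
  add2 (partial2 2 0 F x y) (G (F x y) A A) = hopf_diff k z p ->
  add2 (partial2 0 2 F x y) (G (F x y) B B) = hopf_diff k z q ->
  mean_curvature fubini_study G F x y =
  hopf_diff k z
   (add3 (scale3 (Ci * (Im (herm (add3 p q) a) / E ^ 2)%R) a)
         (scale3 (Ci * (Im (herm (add3 p q) b) / E ^ 2)%R) b)).
Proof.
intros Hp Hq.
unfold mean_curvature, sff_xx, sff_yy, ff_det.
rewrite HFx, HFy, Hp, Hq, !normal_part_frame, ff_xx_frame, ff_yy_frame, ff_xy_frame.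
rewrite hopf_diff_add, !hopf_diff_scale, !herm_add_l by assumption; fold A B.
assert (HE := fr_pos _ _ _ _ Hf); revert HE; clear.
generalize (sff_xy fubini_study G F x y).
destruct A as [[a1 a2] [a3 a4]], B as [[b1 b2] [b3 b4]]; intros [[s1 s2] [s3 s4]] HE.
unfold add2, scal2; simpl.
f_equal; apply injective_projections; simpl; field; lra.
Qed.

Lemma mean_curvature_sq_frame (G : christoffel) (p q : C3) :
  add2 (partial2 2 0 F x y) (G (F x y) A A) = hopf_diff k z p ->
  add2 (partial2 0 2 F x y) (G (F x y) B B) = hopf_diff k z q ->
  mean_curvature_sq fubini_study G F x y =
  (Im (herm (add3 p q) a) ^ 2 + Im (herm (add3 p q) b) ^ 2) / E ^ 3.
Proof.
intros Hp Hq.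
assert (HE := fr_pos _ _ _ _ Hf).
unfold mean_curvature_sq; rewrite (mean_curvature_frame _ _ _ Hp Hq), HF.
rewrite fubini_study_hopf_diff;
  rewrite !herm_add_l, !herm_scale_l, ?herm_add_r, ?herm_scale_r.
- rewrite (fr_a _ _ _ _ Hf), (fr_b _ _ _ _ Hf), (fr_ab _ _ _ _ Hf),
    (herm_eq_0_sym _ _ (fr_ab _ _ _ _ Hf)); simpl; field; lra.
- rewrite (fr_az _ _ _ _ Hf), (fr_bz _ _ _ _ Hf); ring.
Qed.

End Frame.

(** * The derivative of the argument of a determinant *)

Definition cis (t : R) : C := (cos t, sin t).

Lemma cis_neq_0 (t : R) : cis t <> 0.
Proof.
intros A; assert (X := sin2_cos2 t); injection A; intros X1 X2.
rewrite X1, X2 in X; unfold Rsqr in X; lra.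
Qed.

Lemma is_deriveC_cis (b : R -> R) (t b' : R) :
  is_derive b t b' -> is_deriveC (fun s => cis (b s)) t (RtoC b' * (Ci * cis (b t)))%C.
Proof.
intros Hb; split.
- evar_last; [exact (is_derive_comp cos b t _ _ (is_derive_cos (b t)) Hb) | ].
  simpl; unfold scal; simpl; unfold mult; simpl; ring.
- evar_last; [exact (is_derive_comp sin b t _ _ (is_derive_sin (b t)) Hb) | ].
  simpl; unfold scal; simpl; unfold mult; simpl; ring.
Qed.

(** Both sides have the same logarithmic derivative. This compares the derivatives of two angles
    without showing that the angles differ by a constant. *)
Lemma cis_proportional_derive (f g : R -> R) (t f' g' : R) (d : C) :
  (forall s, cis (f s) = (d * cis (g s))%C) ->
  is_derive f t f' -> is_derive g t g' -> f' = g'.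
Proof.
intros H Hf Hg.
assert (Df := is_deriveC_cis _ _ _ Hf).
assert (Dg := is_deriveC_mult _ _ _ _ _ (is_deriveC_const d t) (is_deriveC_cis _ _ _ Hg)).
apply (is_deriveC_ext _ _ _ _ (fun s => eq_sym (H s))) in Dg.
assert (U := is_deriveC_unique _ _ _ _ Df Dg); clear Df Dg.
assert (Hc := cis_neq_0 (f t)).
assert (Hi : Ci <> 0) by (intros A; injection A; lra).
assert (V : RtoC f' = RtoC g').
{ transitivity (f' * (Ci * cis (f t)) / (Ci * cis (f t)))%C; [field; auto | ].
  rewrite U.
  transitivity (g' * Ci * (d * cis (g t)) / (Ci * cis (f t)))%C; [field; auto | ].
  rewrite <- H; field; auto. }
now injection V.
Qed.

(** The logarithmic derivative of e cis(b) is e'/e + i b'; that of the determinant is the sum of the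
    diagonal coefficients in the frame. Multiplying by e and taking imaginary parts removes the real
    number e'. *)
Lemma angle_derivative (Z P Q : R -> C3) (e b : R -> R) (t e' b' : R) (z' p' q' : C3) :
  frame (e t) (Z t) (P t) (Q t) ->
  (forall s, det3 (Z s) (P s) (Q s) = (RtoC (e s) * cis (b s))%C) ->
  is_derive e t e' -> is_derive b t b' ->
  is_derive3 Z t z' -> is_derive3 P t p' -> is_derive3 Q t q' ->
  e t * b' = e t * Im (herm z' (Z t)) + Im (herm p' (P t)) + Im (herm q' (Q t)).
Proof.
intros Hf HD He Hb HZ HP HQ.
assert (D1 := is_deriveC_det3 _ _ _ _ _ _ _ HZ HP HQ).
assert (Dc := is_deriveC_cis _ _ _ Hb).
assert (D2 := is_deriveC_mult _ _ _ _ _ (is_deriveC_real _ _ _ He) Dc).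
apply (is_deriveC_ext _ _ _ _ (fun s => eq_sym (HD s))) in D2.
assert (U := is_deriveC_unique _ _ _ _ D1 D2); clear D1 D2 Dc.
rewrite (det3_frame_1 _ _ _ _ Hf z'), (det3_frame_2 _ _ _ _ Hf p'),
  (det3_frame_3 _ _ _ _ Hf q'), HD in U.
assert (He0 := frame_neq_0 _ _ _ _ Hf).
assert (Hc := cis_neq_0 (b t)); set (c := cis (b t)) in *.
assert (V : (e t * herm z' (Z t) + herm p' (P t) + herm q' (Q t))%C = (RtoC e' + e t * (b' * Ci))%C).
{ transitivity ((herm z' (Z t) * (e t * c) + herm p' (P t) / e t * (e t * c)
     + herm q' (Q t) / e t * (e t * c)) / c)%C.
  - field; auto.
  - rewrite U; field; auto. }
apply (f_equal Im) in V; revert V; simpl; intros V; unfold Im; lra.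
Qed.

(** * Lagrangian tori *)

Lemma locally_hopf_diff (k : chart) (z z' : R -> C3) (t : R) :
  chart_coord k (z t) <> 0 -> (forall s, is_derive3 z s (z' s)) ->
  locally t (fun s => is_derive2 (fun s => hopf_in_chart k (z s)) s (hopf_diff k (z s) (z' s))).
Proof.
intros H Hz.
apply filter_imp with (2 := is_derive3_chart_neq_0 _ _ _ _ H (Hz t)).
intros s Hs; exact (is_derive2_hopf _ _ _ _ Hs (Hz s)).
Qed.

(* The left-hand side is the covariant derivative, along the image of a horizontal curve
   with velocity u and acceleration v at z, of its velocity: see [is_derive2_hopf_diff]. *)
Lemma hopf_second_derivative_christoffel (k : chart) (z u v : C3) :
  chart_coord k z <> 0 -> herm z z = 1 -> herm u z = 0 ->
  let a := (2 * (chart_coord k u / chart_coord k z))%C in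
  let d1 := hopf_diff k z u in let d2 := hopf_diff k z v in
  add2 (fst d2 - a * fst d1, snd d2 - a * snd d1)%C (fs_christoffel (hopf_in_chart k z) d1 d1)
  = d2.
Proof.
intros H Hz Hu a d1 d2; unfold d1 at 3 4; rewrite fs_christoffel_hopf by assumption.
fold a d1; unfold add2; simpl; apply injective_projections; simpl fst; simpl snd; ring.
Qed.

Lemma is_derive_shift (f : R -> R) (t a m : R) :
  is_derive f (t + a) m -> is_derive (fun s => f (s + a)) t m.
Proof.
intros Hf; evar_last.
- apply (is_derive_comp f (fun s => s + a)); [exact Hf | ].
  auto_derive; [auto | reflexivity].
- unfold scal; simpl; unfold mult; simpl; ring.
Qed.

Lemma is_derive3_shift (f : R -> C3) (t a : R) (u : C3) :
  is_derive3 f (t + a) u -> is_derive3 (fun s => f (s + a)) t u.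
Proof.
pose (S := is_derive_shift).
intros ([A0 B0] & [A1 B1] & [A2 B2]).
exact (conj (conj (S _ _ _ _ A0) (S _ _ _ _ B0))
  (conj (conj (S _ _ _ _ A1) (S _ _ _ _ B1)) (conj (S _ _ _ _ A2) (S _ _ _ _ B2)))).
Qed.

Lemma is_deriveC_0_const (f : R -> C) (a b : R) :
  (forall t, is_deriveC f t 0) -> f a = f b.
Proof.
intros H.
assert (K : forall g : R -> R, (forall t, is_derive g t 0) -> forall a b, a < b -> g a = g b).
{ intros g Hg a0 b0 Hab; exact (eq_is_derive g a0 b0 (fun t _ => Hg t) Hab). }
assert (K' : forall g : R -> R, (forall t, is_derive g t 0) -> g a = g b).
{ intros g Hg; destruct (Rtotal_order a b) as [Hab | [Hab | Hab]].
  - now apply K.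
  - now rewrite Hab.
  - symmetry; now apply K. }
apply injective_projections; [apply (K' (fun s => Re (f s))) | apply (K' (fun s => Im (f s)))];
  intros t; apply H.
Qed.

(* The derivative of <r(p + l), r(p)> vanishes, because r(p + l) = c r(p) and r is horizontal. *)
Lemma herm_deck_0 (c : C) (z a b : C3) :
  (c * Cconj c)%C = 1 -> herm a (scale3 c z) = 0 -> herm b z = 0 ->
  (herm a z + herm (scale3 c z) b)%C = 0.
Proof.
intros Hc Ha Hb; rewrite herm_scale_r in Ha.
rewrite herm_scale_l, (herm_eq_0_sym _ _ Hb).
transitivity ((c * Cconj c) * herm a z)%C; [rewrite Hc; ring | ].
transitivity (c * (Cconj c * herm a z))%C; [ring | rewrite Ha; ring].
Qed.

Section Torus.

Variables (r : R -> R -> C3) (v beta : R -> R -> R) (w1 w2 : R * R).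
Hypothesis Htorus : lagrangian_torus r v w1 w2.
Hypothesis Hbeta : lagrangian_angle r beta.

Let Hr := lt_smooth_r _ _ _ _ Htorus.

(** The two normalising factors 1 / sqrt(2 e^v) are moved to the other side, so that no derivative
    of [norm3] has to be taken. *)
Lemma torus_det (x y : R) :
  det3 (r x y) (partial3 1 0 r x y) (partial3 0 1 r x y)
  = (RtoC (2 * exp (v x y)) * cis (beta x y))%C.
Proof.
unfold cis; rewrite (la_det _ _ Hbeta); unfold norm3.
rewrite (lt_conformal_x _ _ _ _ Htorus), (lt_conformal_y _ _ _ _ Htorus).
set (m := 2 * exp (v x y)); change (Re (RtoC m)) with m.
assert (Hm : 0 < m) by (unfold m; generalize (exp_pos (v x y)); lra).
assert (Hs := sqrt_lt_R0 _ Hm).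
assert (E : (RtoC m * (RtoC (/ sqrt m) * RtoC (/ sqrt m)))%C = 1).
{ rewrite <- !RtoC_mult; f_equal; rewrite <- (sqrt_sqrt m) at 1 by lra; field; lra. }
transitivity ((RtoC m * (RtoC (/ sqrt m) * RtoC (/ sqrt m)))
   * det3 (r x y) (partial3 1 0 r x y) (partial3 0 1 r x y))%C.
- rewrite E; ring.
- unfold det3, scale3, c0, c1, c2; simpl fst; simpl snd; ring.
Qed.

Lemma torus_frame (x y : R) :
  frame (2 * exp (v x y)) (r x y) (partial3 1 0 r x y) (partial3 0 1 r x y).
Proof.
assert (H := exp_pos (v x y)).
split; [lra | exact (lt_sphere _ _ _ _ Htorus x y) | exact (lt_horizontal_x _ _ _ _ Htorus x y)
  | exact (lt_horizontal_y _ _ _ _ Htorus x y) | exact (lt_lagrangian _ _ _ _ Htorus x y)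
  | exact (lt_conformal_x _ _ _ _ Htorus x y) | exact (lt_conformal_y _ _ _ _ Htorus x y) | ].
rewrite torus_det; apply Cmult_neq_0; [intros A; injection A; lra | apply cis_neq_0].
Qed.

Lemma torus_derive_metric_x (x y : R) :
  is_derive (fun s => 2 * exp (v s y)) x (2 * (partial_derive 1 0 v x y * exp (v x y))).
Proof.
apply (is_derive_scal (fun s => exp (v s y))).
evar_last; [apply (is_derive_comp exp (fun s => v s y)); [apply is_derive_exp | ] | ].
- exact (smooth2_derive_x v x y (lt_smooth_v _ _ _ _ Htorus)).
- reflexivity.
Qed.

Lemma torus_derive_metric_y (x y : R) :
  is_derive (fun t => 2 * exp (v x t)) y (2 * (partial_derive 0 1 v x y * exp (v x y))).
Proof.
apply (is_derive_scal (fun t => exp (v x t))).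
evar_last; [apply (is_derive_comp exp (fun t => v x t)); [apply is_derive_exp | ] | ].
- exact (smooth2_derive_y v x y (lt_smooth_v _ _ _ _ Htorus)).
- reflexivity.
Qed.

(** Differentiating <r_x, r_y> = 0 along x gives <r_xx, r_y> + <r_x, r_xy> = 0; the second term is
    the conjugate of <r_xy, r_x>, which reverses the sign of its imaginary part. *)
Lemma torus_lagrangian_derive_x (x y : R) :
  Im (herm (partial3 2 0 r x y) (partial3 0 1 r x y))
  = Im (herm (partial3 1 1 r x y) (partial3 1 0 r x y)).
Proof.
assert (D := is_deriveC_herm _ _ _ _ _ (smooth3_derive_xx r x y Hr) (smooth3_derive_yx r x y Hr)).
apply (is_deriveC_ext _ _ _ _ (fun s => lt_lagrangian _ _ _ _ Htorus s y)) in D.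
assert (U := is_deriveC_unique _ _ _ _ D (is_deriveC_const 0 x)).
rewrite <- (herm_conj (partial3 1 1 r x y)) in U.
revert U; destruct (herm (partial3 1 1 r x y) (partial3 1 0 r x y)) as [a1 a2],
  (herm (partial3 2 0 r x y) (partial3 0 1 r x y)) as [b1 b2].
intros U; injection U; simpl; lra.
Qed.

Lemma torus_lagrangian_derive_y (x y : R) :
  Im (herm (partial3 0 2 r x y) (partial3 1 0 r x y))
  = Im (herm (partial3 1 1 r x y) (partial3 0 1 r x y)).
Proof.
assert (D := is_deriveC_herm _ _ _ _ _ (smooth3_derive_xy r x y Hr) (smooth3_derive_yy r x y Hr)).
apply (is_deriveC_ext _ _ _ _ (fun t => lt_lagrangian _ _ _ _ Htorus x t)) in D.
assert (U := is_deriveC_unique _ _ _ _ D (is_deriveC_const 0 y)).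
rewrite <- (herm_conj (partial3 0 2 r x y)) in U.
revert U; destruct (herm (partial3 1 1 r x y) (partial3 0 1 r x y)) as [a1 a2],
  (herm (partial3 0 2 r x y) (partial3 1 0 r x y)) as [b1 b2].
intros U; injection U; simpl; lra.
Qed.

Let L (x y : R) : C3 := add3 (partial3 2 0 r x y) (partial3 0 2 r x y).

(** [angle_derivative] gives Im <r_xx, r_x> + Im <r_xy, r_y>, the term in <r_x, r> being zero; the
    Lagrangian condition replaces the last product by <r_yy, r_x>. *)
Lemma torus_angle_x (x y : R) :
  2 * exp (v x y) * partial_derive 1 0 beta x y = Im (herm (L x y) (partial3 1 0 r x y)).
Proof.
rewrite (angle_derivative (fun s => r s y) (fun s => partial3 1 0 r s y)
  (fun s => partial3 0 1 r s y) (fun s => 2 * exp (v s y)) (fun s => beta s y) x _ _ _ _ _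
  (torus_frame x y) (fun s => torus_det s y) (torus_derive_metric_x x y)
  (smooth2_derive_x beta x y (la_smooth _ _ Hbeta)) (smooth3_derive_x r x y Hr)
  (smooth3_derive_xx r x y Hr) (smooth3_derive_yx r x y Hr)).
rewrite (lt_horizontal_x _ _ _ _ Htorus); unfold L.
rewrite herm_add_l, im_plus, torus_lagrangian_derive_y; simpl; ring.
Qed.

Lemma torus_angle_y (x y : R) :
  2 * exp (v x y) * partial_derive 0 1 beta x y = Im (herm (L x y) (partial3 0 1 r x y)).
Proof.
rewrite (angle_derivative (fun t => r x t) (fun t => partial3 1 0 r x t)
  (fun t => partial3 0 1 r x t) (fun t => 2 * exp (v x t)) (fun t => beta x t) y _ _ _ _ _
  (torus_frame x y) (fun t => torus_det x t) (torus_derive_metric_y x y)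
  (smooth2_derive_y beta x y (la_smooth _ _ Hbeta)) (smooth3_derive_y r x y Hr)
  (smooth3_derive_xy r x y Hr) (smooth3_derive_yy r x y Hr)).
rewrite (lt_horizontal_y _ _ _ _ Htorus); unfold L.
rewrite herm_add_l, im_plus, torus_lagrangian_derive_x; simpl; ring.
Qed.

(** * The induced area and the mean curvature at a point of the torus *)

Section Chart.

Variables (k : chart) (x y : R).
Hypothesis Hk : chart_coord k (r x y) <> 0.

Let F (s t : R) : C2 := hopf_in_chart k (r s t).

Lemma hopf_torus_x : partial2 1 0 F x y = hopf_diff k (r x y) (partial3 1 0 r x y).
Proof.
apply partial2_1_0, (is_derive2_hopf k (fun s => r s y)); [exact Hk | ].
now apply smooth3_derive_x.
Qed.

Lemma hopf_torus_y : partial2 0 1 F x y = hopf_diff k (r x y) (partial3 0 1 r x y).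
Proof.
apply partial2_0_1, (is_derive2_hopf k (fun t => r x t)); [exact Hk | ].
now apply smooth3_derive_y.
Qed.

Lemma area_density_torus : area_density fubini_study F x y = 2 * exp (v x y).
Proof.
exact (area_density_frame _ _ _ _ (torus_frame x y) k Hk F x y eq_refl hopf_torus_x hopf_torus_y).
Qed.

Lemma mean_curvature_sq_torus (G : christoffel) : levi_civita fubini_study G ->
  mean_curvature_sq fubini_study G F x y * (2 * exp (v x y))
  = partial_derive 1 0 beta x y ^ 2 + partial_derive 0 1 beta x y ^ 2.
Proof.
intros HG; assert (HE := exp_pos (v x y)).
rewrite (mean_curvature_sq_frame _ _ _ _ (torus_frame x y) k Hk F x y eq_refl
  hopf_torus_x hopf_torus_y G (partial3 2 0 r x y) (partial3 0 2 r x y)).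
(* With E = 2 e^v both imaginary parts are E times a partial derivative of beta, so E^2 / E^3
   cancels against the area factor E. *)
- fold (L x y); rewrite <- torus_angle_x, <- torus_angle_y; field; lra.
- rewrite (levi_civita_fubini_study_unique _ _ _ _ HG).
  rewrite (partial2_2_0 F _ x y _
    (locally_hopf_diff k (fun s => r s y) _ x Hk (fun s => smooth3_derive_x r s y Hr))
    (is_derive2_hopf_diff k (fun s => r s y) _ x _ Hk (smooth3_derive_x r x y Hr)
       (smooth3_derive_xx r x y Hr))).
  exact (hopf_second_derivative_christoffel k _ _ _ Hk (lt_sphere _ _ _ _ Htorus x y)
    (lt_horizontal_x _ _ _ _ Htorus x y)).
- rewrite (levi_civita_fubini_study_unique _ _ _ _ HG).
  rewrite (partial2_0_2 F _ x y _
    (locally_hopf_diff k (fun t => r x t) _ y Hk (fun t => smooth3_derive_y r x t Hr))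
    (is_derive2_hopf_diff k (fun t => r x t) _ y _ Hk (smooth3_derive_y r x y Hr)
       (smooth3_derive_yy r x y Hr))).
  exact (hopf_second_derivative_christoffel k _ _ _ Hk (lt_sphere _ _ _ _ Htorus x y)
    (lt_horizontal_y _ _ _ _ Htorus x y)).
Qed.

End Chart.

(** * Lattice translations and the periodicity of grad beta *)

Section Period.

Variable l : R * R.
Hypothesis Hl : in_lattice w1 w2 l.

(** [same_hopf] only asserts that a unit factor exists at each point, with no regularity in the
    point. The Hermitian product recovers that factor as a function that can be differentiated. *)
Let c (x y : R) : C := herm (r (x + fst l) (y + snd l)) (r x y).

Lemma torus_deck (x y : R) :
  r (x + fst l) (y + snd l) = scale3 (c x y) (r x y) /\ (c x y * Cconj (c x y))%C = 1.
Proof.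
destruct (lt_periodic _ _ _ _ Htorus l Hl x y) as [d [Hd E]].
assert (D : c x y = d).
{ unfold c; rewrite E, herm_scale_l, (lt_sphere _ _ _ _ Htorus); ring. }
rewrite D; split; [exact E | ].
rewrite <- Cmod2_conj, Hd; f_equal; ring.
Qed.

Lemma torus_deck_derive_x (x y : R) : is_deriveC (fun s => c s y) x 0.
Proof.
rewrite <- (herm_deck_0 (c x y) (r x y) (partial3 1 0 r (x + fst l) (y + snd l))
  (partial3 1 0 r x y)).
- rewrite <- (proj1 (torus_deck x y)).
  exact (is_deriveC_herm (fun s => r (s + fst l) (y + snd l)) (fun s => r s y) _ _ _
    (is_derive3_shift (fun s => r s (y + snd l)) _ _ _ (smooth3_derive_x r _ _ Hr))
    (smooth3_derive_x r x y Hr)).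
- apply torus_deck.
- rewrite <- (proj1 (torus_deck x y)).
  exact (lt_horizontal_x _ _ _ _ Htorus (x + fst l) (y + snd l)).
- exact (lt_horizontal_x _ _ _ _ Htorus x y).
Qed.

Lemma torus_deck_derive_y (x y : R) : is_deriveC (fun t => c x t) y 0.
Proof.
rewrite <- (herm_deck_0 (c x y) (r x y) (partial3 0 1 r (x + fst l) (y + snd l))
  (partial3 0 1 r x y)).
- rewrite <- (proj1 (torus_deck x y)).
  exact (is_deriveC_herm (fun t => r (x + fst l) (t + snd l)) (fun t => r x t) _ _ _
    (is_derive3_shift (fun t => r (x + fst l) t) _ _ _ (smooth3_derive_y r _ _ Hr))
    (smooth3_derive_y r x y Hr)).
- apply torus_deck.
- rewrite <- (proj1 (torus_deck x y)).
  exact (lt_horizontal_y _ _ _ _ Htorus (x + fst l) (y + snd l)).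
- exact (lt_horizontal_y _ _ _ _ Htorus x y).
Qed.

Lemma torus_deck_const (x y : R) :
  r (x + fst l) (y + snd l) = scale3 (c 0 0) (r x y).
Proof.
replace (c 0 0) with (c x y); [apply torus_deck | ].
transitivity (c 0 y).
- apply (is_deriveC_0_const (fun s => c s y)); intros s; apply torus_deck_derive_x.
- apply (is_deriveC_0_const (fun t => c 0 t)); intros t; apply torus_deck_derive_y.
Qed.

Lemma torus_deck_partial_x (x y : R) :
  partial3 1 0 r (x + fst l) (y + snd l) = scale3 (c 0 0) (partial3 1 0 r x y).
Proof.
apply (is_derive3_unique (fun s => r (s + fst l) (y + snd l)) x).
- apply (is_derive3_shift (fun s => r s (y + snd l))); now apply smooth3_derive_x.
- apply (is_derive3_ext (fun s => scale3 (c 0 0) (r s y))).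
  + intros s; symmetry; apply torus_deck_const.
  + apply is_derive3_scale; now apply smooth3_derive_x.
Qed.

Lemma torus_deck_partial_y (x y : R) :
  partial3 0 1 r (x + fst l) (y + snd l) = scale3 (c 0 0) (partial3 0 1 r x y).
Proof.
apply (is_derive3_unique (fun t => r (x + fst l) (t + snd l)) y).
- apply (is_derive3_shift (fun t => r (x + fst l) t)); now apply smooth3_derive_y.
- apply (is_derive3_ext (fun t => scale3 (c 0 0) (r x t))).
  + intros s; symmetry; apply torus_deck_const.
  + apply is_derive3_scale; now apply smooth3_derive_y.
Qed.

Lemma torus_deck_angle : exists d : C, forall x y,
  cis (beta (x + fst l) (y + snd l))
  = (d * cis (beta x y))%C.
Proof.
exists (c 0 0 * c 0 0 * c 0 0)%C; intros x y.
(* The conformal factor is periodic because r_x is multiplied by a constant of modulus one. *)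
assert (V : exp (v (x + fst l) (y + snd l)) = exp (v x y)).
{ assert (X := lt_conformal_x _ _ _ _ Htorus (x + fst l) (y + snd l)).
  rewrite torus_deck_partial_x, herm_scale_l, herm_scale_r, (lt_conformal_x _ _ _ _ Htorus) in X.
  rewrite Cmult_assoc, (proj2 (torus_deck 0 0)), Cmult_1_l in X.
  injection X; lra. }
assert (He : RtoC (2 * exp (v x y)) <> 0)
  by (intros A; injection A; generalize (exp_pos (v x y)); lra).
assert (D := torus_det (x + fst l) (y + snd l)).
rewrite torus_deck_const, torus_deck_partial_x, torus_deck_partial_y, V in D.
assert (D' : (RtoC (2 * exp (v x y)) * (c 0 0 * c 0 0 * c 0 0 * cis (beta x y)))%C
  = (RtoC (2 * exp (v x y)) * cis (beta (x + fst l) (y + snd l)))%C).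
{ rewrite <- D.
  transitivity (c 0 0 * c 0 0 * c 0 0 * (RtoC (2 * exp (v x y)) * cis (beta x y)))%C;
    [ring | ].
  rewrite <- torus_det; unfold det3, scale3, c0, c1, c2; simpl fst; simpl snd; ring. }
apply (f_equal (Cmult (/ RtoC (2 * exp (v x y))))) in D'.
rewrite !(Cmult_assoc (/ _)), !Cinv_l, !Cmult_1_l in D' by assumption; auto.
Qed.

Lemma torus_angle_partial_x_periodic (x y : R) :
  partial_derive 1 0 beta (x + fst l) (y + snd l) = partial_derive 1 0 beta x y.
Proof.
destruct torus_deck_angle as [d Hd].
apply (cis_proportional_derive (fun s => beta (s + fst l) (y + snd l)) (fun s => beta s y) x _ _ d
  (fun s => Hd s y)).
- apply (is_derive_shift (fun s => beta s (y + snd l))).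
  exact (smooth2_derive_x beta _ _ (la_smooth _ _ Hbeta)).
- exact (smooth2_derive_x beta _ _ (la_smooth _ _ Hbeta)).
Qed.

Lemma torus_angle_partial_y_periodic (x y : R) :
  partial_derive 0 1 beta (x + fst l) (y + snd l) = partial_derive 0 1 beta x y.
Proof.
destruct torus_deck_angle as [d Hd].
apply (cis_proportional_derive (fun t => beta (x + fst l) (t + snd l)) (fun t => beta x t) y _ _ d
  (fun t => Hd x t)).
- apply (is_derive_shift (fun t => beta (x + fst l) t)).
  exact (smooth2_derive_y beta _ _ (la_smooth _ _ Hbeta)).
- exact (smooth2_derive_y beta _ _ (la_smooth _ _ Hbeta)).
Qed.

End Period.

End Torus.

(** * Integrals over a fundamental parallelogram *)

Lemma continuity_2d_pt_section (f : R -> R -> R) (s t : R) :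
  continuity_2d_pt f s t -> continuous (fun t => f s t) t.
Proof.
intros H; apply continuity_2d_pt_filterlim in H.
exact (continuous_comp_2 (fun _ : R => s) (fun t : R => t) f t
  (continuous_const s t) (continuous_id t) H).
Qed.

Lemma ex_RInt_section (f : R -> R -> R) (s a b : R) :
  (forall s t, continuity_2d_pt f s t) -> ex_RInt (fun t => f s t) a b.
Proof.
intros H; apply (ex_RInt_continuous (f s)); intros t _.
exact (continuity_2d_pt_section f s t (H s t)).
Qed.

Lemma continuity_2d_pt_swap (f : R -> R -> R) (s t : R) :
  continuity_2d_pt f s t -> continuity_2d_pt (fun t s => f s t) t s.
Proof.
intros H eps; destruct (H eps) as [delta Hd]; exists delta; intros u v Hu Hv.
exact (Hd v u Hv Hu).
Qed.

(** Compactness of [0, 1] gives one delta valid for all t; eps / 2 turns the weak bound on the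
    integral into a strict one. *)
Lemma continuous_RInt_section (f : R -> R -> R) (s : R) :
  (forall s t, continuity_2d_pt f s t) -> continuous (fun s => RInt (fun t => f s t) 0 1) s.
Proof.
intros H.
apply continuity_pt_filterlim.
intros eps Heps.
assert (H2 : 0 < eps / 2) by lra.
destruct (uniform_continuity_2d_1d (fun t s => f s t) 0 1 s
  (fun t _ => continuity_2d_pt_swap f s t (H s t)) (mkposreal _ H2)) as [delta Hd].
assert (Hdelta := cond_pos delta).
exists delta; split; [exact Hdelta | ].
intros u [_ Hu].
change (Rabs (u - s) < delta) in Hu.
change (Rabs (RInt (fun t => f u t) 0 1 - RInt (fun t => f s t) 0 1) < eps).
assert (Eu := ex_RInt_section f u 0 1 H); assert (Es := ex_RInt_section f s 0 1 H).
replace (RInt (fun t => f u t) 0 1 - RInt (fun t => f s t) 0 1)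
  with (RInt (fun t => f u t - f s t) 0 1) by exact (RInt_minus _ _ 0 1 Eu Es).
apply Rle_lt_trans with ((1 - 0) * (eps / 2)); [ | lra].
apply abs_RInt_le_const; [lra | exact (ex_RInt_minus _ _ 0 1 Eu Es) | ].
intros t Ht; apply Rlt_le.
apply Rabs_lt_between in Hu.
apply (Hd t s t u Ht); [lra | exact Ht | lra | ].
rewrite Rminus_diag, Rabs_R0; exact Hdelta.
Qed.

Lemma smooth2_chain (f : R -> R -> R) (g h : R -> R) (t g' h' : R) :
  smooth2 f -> is_derive g t g' -> is_derive h t h' ->
  is_derive (fun s => f (g s) (h s)) t
    (partial_derive 1 0 f (g t) (h t) * g' + partial_derive 0 1 f (g t) (h t) * h').
Proof.
intros Hf Hg Hh; apply is_derive_Reals in Hg, Hh; apply is_derive_Reals.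
refine (derivable_pt_lim_comp_2d f g h t _ _ _ _ _ Hg Hh).
apply filterdiff_differentiable_pt_lim.
apply (is_derive_filterdiff f _ _ (partial_derive 1 0 f)).
- apply filter_forall; intros u; exact (smooth2_derive_x f _ _ Hf).
- exact (smooth2_derive_y f _ _ Hf).
- apply continuity_2d_pt_filterlim.
  exact (smooth2_continuous _ _ _ (smooth2_partial_x f Hf)).
Qed.

(** The order of integration is never exchanged: B' already integrates to 0 in the inner variable,
    and the inner integral of A' is the s-derivative of the inner integral of A, by differentiation
    under the integral sign. *)
Lemma RInt_square_divergence (A B A' B' : R -> R -> R) :
  (forall s t, is_derive (fun s => A s t) s (A' s t)) ->
  (forall s t, is_derive (fun t => B s t) t (B' s t)) ->
  (forall s t, continuity_2d_pt A s t) ->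
  (forall s t, continuity_2d_pt A' s t) -> (forall s t, continuity_2d_pt B' s t) ->
  (forall t, A 1 t = A 0 t) -> (forall s, B s 1 = B s 0) ->
  RInt (fun s => RInt (fun t => A' s t + B' s t) 0 1) 0 1 = 0.
Proof.
intros HA HB CA CA' CB' PA PB.
assert (DA : forall s, is_derive (fun s => RInt (fun t => A s t) 0 1) s (RInt (fun t => A' s t) 0 1)).
{ intros s.
  rewrite (RInt_ext (fun t => A' s t) (fun t => Derive (fun s => A s t) s))
    by (intros t _; symmetry; exact (is_derive_unique _ _ _ (HA s t))).
  apply is_derive_RInt_param.
  - apply filter_forall; intros u t _; exact (ex_intro _ _ (HA u t)).
  - intros t _; apply (continuity_2d_pt_ext A'); [ | apply CA'].
    intros u w; symmetry; exact (is_derive_unique _ _ _ (HA u w)).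
  - apply filter_forall; intros u; exact (ex_RInt_section A u 0 1 CA). }
rewrite (RInt_ext _ (fun s => RInt (fun t => A' s t) 0 1)).
- apply is_RInt_unique.
  evar_last.
  + apply (is_RInt_derive (fun s => RInt (fun t => A s t) 0 1)).
    * intros s _; exact (DA s).
    * intros s _; exact (continuous_RInt_section A' s CA').
  + rewrite (RInt_ext (fun t => A 1 t) (fun t => A 0 t)) by (intros t _; exact (PA t)).
    apply (plus_opp_r (G := R_AbelianGroup)).
- intros s _.
  assert (EB : RInt (fun t => B' s t) 0 1 = 0).
  { apply is_RInt_unique.
    evar_last.
    - apply (is_RInt_derive (fun t => B s t)).
      + intros t _; exact (HB s t).
      + intros t _; exact (continuity_2d_pt_section B' s t (CB' s t)).
    - rewrite PB; apply (plus_opp_r (G := R_AbelianGroup)). }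
  transitivity (RInt (fun t => A' s t) 0 1 + RInt (fun t => B' s t) 0 1).
  + exact (RInt_plus _ _ 0 1 (ex_RInt_section A' s 0 1 CA') (ex_RInt_section B' s 0 1 CB')).
  + rewrite EB; exact (Rplus_0_r _).
Qed.

Section Lattice.

Variables w1 w2 : R * R.

Let X (s t : R) : R := s * fst w1 + t * fst w2.
Let Y (s t : R) : R := s * snd w1 + t * snd w2.

Lemma continuity_2d_pt_lattice (f : R -> R -> R) :
  (forall x y, continuity_2d_pt f x y) ->
  forall s t, continuity_2d_pt (fun s t => f (X s t) (Y s t)) s t.
Proof.
intros H s t; apply continuity_2d_pt_filterlim.
assert (L : forall a b, continuous (fun z : R * R => fst z * a + snd z * b) (s, t)).
{ intros a b.
  exact (continuous_plus (fun z : R * R => fst z * a) (fun z : R * R => snd z * b) _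
    (continuous_mult (fun z : R * R => fst z) (fun _ => a) (s, t)
       (continuous_fst _ _) (continuous_const _ _))
    (continuous_mult (fun z : R * R => snd z) (fun _ => b) (s, t)
       (continuous_snd _ _) (continuous_const _ _))). }
apply (continuous_comp_2 (fun z : R * R => fst z * fst w1 + snd z * fst w2)
  (fun z : R * R => fst z * snd w1 + snd z * snd w2) f (s, t) (L _ _) (L _ _)).
apply continuity_2d_pt_filterlim, H.
Qed.

Lemma torus_int_ext (f g : R -> R -> R) :
  (forall x y, f x y = g x y) -> torus_int w1 w2 f = torus_int w1 w2 g.
Proof.
intros H; unfold torus_int; f_equal.
apply RInt_ext; intros s _; apply RInt_ext; intros t _; apply H.
Qed.

Lemma ex_RInt_lattice (f : R -> R -> R) :
  (forall x y, continuity_2d_pt f x y) ->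
  ex_RInt (fun s => RInt (fun t => f (X s t) (Y s t)) 0 1) 0 1.
Proof.
intros H; apply (ex_RInt_continuous (fun s => RInt (fun t => f (X s t) (Y s t)) 0 1)).
intros s _.
exact (continuous_RInt_section (fun s t => f (X s t) (Y s t)) s (continuity_2d_pt_lattice f H)).
Qed.

Lemma torus_int_plus (f g : R -> R -> R) :
  (forall x y, continuity_2d_pt f x y) -> (forall x y, continuity_2d_pt g x y) ->
  torus_int w1 w2 (fun x y => f x y + g x y) = torus_int w1 w2 f + torus_int w1 w2 g.
Proof.
intros Hf Hg; unfold torus_int; rewrite <- Rmult_plus_distr_l; f_equal.
transitivity (RInt (fun s => RInt (fun t => f (X s t) (Y s t)) 0 1
   + RInt (fun t => g (X s t) (Y s t)) 0 1) 0 1).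
- apply RInt_ext; intros s _.
  exact (RInt_plus _ _ 0 1 (ex_RInt_section _ s 0 1 (continuity_2d_pt_lattice f Hf))
    (ex_RInt_section _ s 0 1 (continuity_2d_pt_lattice g Hg))).
- exact (RInt_plus _ _ 0 1 (ex_RInt_lattice f Hf) (ex_RInt_lattice g Hg)).
Qed.

Lemma torus_int_scal (c : R) (f : R -> R -> R) :
  (forall x y, continuity_2d_pt f x y) ->
  torus_int w1 w2 (fun x y => c * f x y) = c * torus_int w1 w2 f.
Proof.
intros Hf; unfold torus_int; rewrite <- Rmult_assoc, (Rmult_comm c), Rmult_assoc; f_equal.
transitivity (RInt (fun s => c * RInt (fun t => f (X s t) (Y s t)) 0 1) 0 1).
- apply RInt_ext; intros s _.
  exact (RInt_scal _ 0 1 c (ex_RInt_section _ s 0 1 (continuity_2d_pt_lattice f Hf))).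
- exact (RInt_scal _ 0 1 c (ex_RInt_lattice f Hf)).
Qed.

Lemma smooth2_lattice_derive (f : R -> R -> R) (s t : R) : smooth2 f ->
  is_derive (fun s => f (X s t) (Y s t)) s
    (partial_derive 1 0 f (X s t) (Y s t) * fst w1
     + partial_derive 0 1 f (X s t) (Y s t) * snd w1) /\
  is_derive (fun t => f (X s t) (Y s t)) t
    (partial_derive 1 0 f (X s t) (Y s t) * fst w2
     + partial_derive 0 1 f (X s t) (Y s t) * snd w2).
Proof.
intros Hf.
assert (L1 : forall a b, is_derive (fun s => s * a + t * b) s a)
  by (intros; auto_derive; auto; ring).
assert (L2 : forall a b, is_derive (fun t => s * a + t * b) t b)
  by (intros; auto_derive; auto; ring).
exact (conj (smooth2_chain f _ _ s _ _ Hf (L1 _ _) (L1 _ _))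
  (smooth2_chain f _ _ t _ _ Hf (L2 _ _) (L2 _ _))).
Qed.

Lemma is_derive_lin (f g : R -> R) (a b t f' g' : R) :
  is_derive f t f' -> is_derive g t g' ->
  is_derive (fun t => a * f t + b * g t) t (a * f' + b * g').
Proof.
intros Hf Hg.
exact (is_derive_plus (fun t => a * f t) (fun t => b * g t) t _ _
  (is_derive_scal f t a f' Hf) (is_derive_scal g t b g' Hg)).
Qed.

Lemma continuity_2d_pt_lin (f g : R -> R -> R) (a b s t : R) :
  continuity_2d_pt f s t -> continuity_2d_pt g s t ->
  continuity_2d_pt (fun s t => a * f s t + b * g s t) s t.
Proof.
intros Hf Hg.
exact (continuity_2d_pt_plus _ _ s t
  (continuity_2d_pt_mult _ _ s t (continuity_2d_pt_const s t a) Hf)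
  (continuity_2d_pt_mult _ _ s t (continuity_2d_pt_const s t b) Hg)).
Qed.

(** Pulled back to the unit square, periodicity under w1 and w2 identifies opposite sides, and a
    divergence in (x, y) is again a divergence in (s, t), with constant coefficients. *)
Lemma torus_int_divergence (P Q : R -> R -> R) :
  det2 w1 w2 <> 0 -> smooth2 P -> smooth2 Q ->
  (forall l, in_lattice w1 w2 l -> forall x y, P (x + fst l) (y + snd l) = P x y) ->
  (forall l, in_lattice w1 w2 l -> forall x y, Q (x + fst l) (y + snd l) = Q x y) ->
  torus_int w1 w2 (fun x y => partial_derive 1 0 P x y + partial_derive 0 1 Q x y) = 0.
Proof.
intros Hd HP HQ PP PQ.
assert (L1 : in_lattice w1 w2 w1)
  by (exists 1%Z, 0%Z; apply injective_projections; simpl; ring).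
assert (L2 : in_lattice w1 w2 w2)
  by (exists 0%Z, 1%Z; apply injective_projections; simpl; ring).
assert (S1 : forall f, (forall x y, f (x + fst w1) (y + snd w1) = f x y) ->
  forall t, f (X 1 t) (Y 1 t) = f (X 0 t) (Y 0 t) :> R).
{ intros f Hf t; rewrite <- (Hf (X 0 t)); unfold X, Y; f_equal; ring. }
assert (S2 : forall f, (forall x y, f (x + fst w2) (y + snd w2) = f x y) ->
  forall s, f (X s 1) (Y s 1) = f (X s 0) (Y s 0) :> R).
{ intros f Hf t; rewrite <- (Hf (X t 0)); unfold X, Y; f_equal; ring. }
assert (P1 := S1 _ (PP _ L1)); assert (P2 := S2 _ (PP _ L2)).
assert (Q1 := S1 _ (PQ _ L1)); assert (Q2 := S2 _ (PQ _ L2)).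
pose (pull f s t := f (X s t) (Y s t) : R).
pose (ds f s t := partial_derive 1 0 f (X s t) (Y s t) * fst w1
  + partial_derive 0 1 f (X s t) (Y s t) * snd w1).
pose (dt f s t := partial_derive 1 0 f (X s t) (Y s t) * fst w2
  + partial_derive 0 1 f (X s t) (Y s t) * snd w2).
assert (C0 : forall f, smooth2 f -> forall s t, continuity_2d_pt (pull f) s t).
{ intros f Hf; apply continuity_2d_pt_lattice; intros x y; exact (smooth2_continuous f x y Hf). }
assert (Cs : forall f, smooth2 f -> forall s t, continuity_2d_pt (ds f) s t).
{ intros f Hf s t.
  apply (continuity_2d_pt_ext (fun s t => fst w1 * pull (partial_derive 1 0 f) s t
    + snd w1 * pull (partial_derive 0 1 f) s t)).
  - intros; unfold ds, pull; ring.
  - apply continuity_2d_pt_lin; apply C0; [now apply smooth2_partial_x | now apply smooth2_partial_y]. }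
assert (Ct : forall f, smooth2 f -> forall s t, continuity_2d_pt (dt f) s t).
{ intros f Hf s t.
  apply (continuity_2d_pt_ext (fun s t => fst w2 * pull (partial_derive 1 0 f) s t
    + snd w2 * pull (partial_derive 0 1 f) s t)).
  - intros; unfold dt, pull; ring.
  - apply continuity_2d_pt_lin; apply C0; [now apply smooth2_partial_x | now apply smooth2_partial_y]. }
pose (d := det2 w1 w2).
unfold torus_int.
(* The coefficients invert the linear parametrisation: d/dx = (snd w2 d/ds - snd w1 d/dt) / d and
   d/dy = (- fst w2 d/ds + fst w1 d/dt) / d. *)
rewrite (RInt_ext _ (fun s => RInt (fun t =>
   (snd w2 / d * ds P s t + - fst w2 / d * ds Q s t)
   + (- snd w1 / d * dt P s t + fst w1 / d * dt Q s t)) 0 1)).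
- rewrite (RInt_square_divergence
    (fun s t => snd w2 / d * pull P s t + - fst w2 / d * pull Q s t)
    (fun s t => - snd w1 / d * pull P s t + fst w1 / d * pull Q s t)
    (fun s t => snd w2 / d * ds P s t + - fst w2 / d * ds Q s t)
    (fun s t => - snd w1 / d * dt P s t + fst w1 / d * dt Q s t)).
  + ring.
  + intros s t; exact (is_derive_lin _ _ _ _ _ _ _ (proj1 (smooth2_lattice_derive P s t HP))
      (proj1 (smooth2_lattice_derive Q s t HQ))).
  + intros s t; exact (is_derive_lin _ _ _ _ _ _ _ (proj2 (smooth2_lattice_derive P s t HP))
      (proj2 (smooth2_lattice_derive Q s t HQ))).
  + intros s t; exact (continuity_2d_pt_lin _ _ _ _ _ _ (C0 P HP s t) (C0 Q HQ s t)).
  + intros s t; exact (continuity_2d_pt_lin _ _ _ _ _ _ (Cs P HP s t) (Cs Q HQ s t)).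
  + intros s t; exact (continuity_2d_pt_lin _ _ _ _ _ _ (Ct P HP s t) (Ct Q HQ s t)).
  + intros t; unfold pull; rewrite P1, Q1; reflexivity.
  + intros s; unfold pull; rewrite P2, Q2; reflexivity.
- intros s _; apply RInt_ext; intros t _; fold (X s t) (Y s t).
  match goal with |- ?a = ?b => change (a = b :> R) end.
  unfold ds, dt, d, det2; field; exact Hd.
Qed.

End Lattice.

Theorem lemma2 (r : R -> R -> C3) (v beta : R -> R -> R) (w1 w2 : R * R)
  (G : christoffel) (k : R -> R -> chart)
  (Htorus : lagrangian_torus r v w1 w2)
  (Hbeta : lagrangian_angle r beta)
  (HG : levi_civita fubini_study G)
  (Hk : forall x y : R, chart_coord (k x y) (r x y) <> RtoC 0) :
  let Sigma := fun x y : R => fun s t : R => hopf_in_chart (k x y) (r s t) in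
  let dsigma := fun x y : R => area_density fubini_study (Sigma x y) x y in
  let H2 := fun x y : R => mean_curvature_sq fubini_study G (Sigma x y) x y in
  energy v beta w1 w2 =
  RtoC (torus_int w1 w2 dsigma
        + / 8 * torus_int w1 w2 (fun x y => H2 x y * dsigma x y)).
Proof.
intros Sigma dsigma H2.
set (area := fun x y => 2 * exp (v x y)).
set (grad := fun x y => partial_derive 1 0 beta x y ^ 2 + partial_derive 0 1 beta x y ^ 2).
(* Each point uses its own chart [k x y]; these pointwise identities replace the chart-dependent
   integrands by chart-free continuous ones, to which linearity of the integral applies. *)
assert (Ed : forall x y, dsigma x y = area x y).
{ intros x y; exact (area_density_torus _ _ _ _ _ Htorus Hbeta _ x y (Hk x y)). }
assert (EH : forall x y, H2 x y * dsigma x y = grad x y).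
{ intros x y; rewrite Ed.
  exact (mean_curvature_sq_torus _ _ _ _ _ Htorus Hbeta _ x y (Hk x y) G HG). }
rewrite (torus_int_ext _ _ _ _ Ed), (torus_int_ext _ _ _ _ EH).
assert (Hv := lt_smooth_v _ _ _ _ Htorus); assert (Hb := la_smooth _ _ Hbeta).
assert (Bx := smooth2_partial_x beta Hb); assert (By := smooth2_partial_y beta Hb).
assert (Ca : forall x y, continuity_2d_pt area x y).
{ intros x y.
  refine (continuity_1d_2d_pt_comp (fun u => 2 * exp u) v x y _ (smooth2_continuous v x y Hv)).
  apply derivable_continuous_pt; reg. }
assert (Cg : forall x y, continuity_2d_pt grad x y).
{ intros x y; apply continuity_2d_pt_plus.
  - refine (continuity_1d_2d_pt_comp (fun u => u ^ 2) _ x y _ (smooth2_continuous _ x y Bx)).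
    apply derivable_continuous_pt; reg.
  - refine (continuity_1d_2d_pt_comp (fun u => u ^ 2) _ x y _ (smooth2_continuous _ x y By)).
    apply derivable_continuous_pt; reg. }
assert (Cscal : forall c f, (forall x y, continuity_2d_pt f x y) ->
  forall x y, continuity_2d_pt (fun x y => c * f x y) x y).
{ intros c f Hf x y; exact (continuity_2d_pt_mult _ _ x y (continuity_2d_pt_const x y c) (Hf x y)). }
(* The term 4 e^v of the potential is twice the area density; the factor 1/2 of the energy turns the
   coefficients 2 and 1/4 into 1 and 1/8. *)
assert (ERe : torus_int w1 w2 (fun x y => Re (potential v beta x y))
  = 2 * torus_int w1 w2 area + / 4 * torus_int w1 w2 grad).
{ rewrite <- (torus_int_scal _ _ 2 area Ca), <- (torus_int_scal _ _ (/ 4) grad Cg).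
  rewrite <- (torus_int_plus _ _ _ _ (Cscal _ _ Ca) (Cscal _ _ Cg)).
  apply torus_int_ext; intros x y; unfold potential, area, grad, Re; simpl; field. }
assert (EIm : torus_int w1 w2 (fun x y => Im (potential v beta x y)) = 0).
(* The Laplacian is written as the divergence of the pair (beta_x, beta_y), whose entries are
   periodic even when beta is not. *)
{ set (lap := fun x y => partial_derive 1 0 (partial_derive 1 0 beta) x y
     + partial_derive 0 1 (partial_derive 0 1 beta) x y).
  assert (Cl : forall x y, continuity_2d_pt lap x y).
  { intros x y; apply continuity_2d_pt_plus.
    - exact (smooth2_continuous _ x y (smooth2_partial_x _ Bx)).
    - exact (smooth2_continuous _ x y (smooth2_partial_y _ By)). }
  transitivity (torus_int w1 w2 (fun x y => / 2 * lap x y)).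
  - apply torus_int_ext; intros x y.
    unfold potential, Im, lap.
    change (partial_derive 1 0 (partial_derive 1 0 beta) x y) with (partial_derive 2 0 beta x y).
    change (partial_derive 0 1 (partial_derive 0 1 beta) x y) with (partial_derive 0 2 beta x y).
    simpl; field.
  - rewrite (torus_int_scal _ _ _ _ Cl); unfold lap.
    rewrite (torus_int_divergence w1 w2 _ _ (lt_lattice _ _ _ _ Htorus) Bx By).
    + ring.
    + intros l Hl; exact (torus_angle_partial_x_periodic _ _ _ _ _ Htorus Hbeta l Hl).
    + intros l Hl; exact (torus_angle_partial_y_periodic _ _ _ _ _ Htorus Hbeta l Hl). }
unfold energy, torus_intC; rewrite ERe, EIm.
apply injective_projections; simpl; field.
Qed.
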